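(* Let $G$ be a locally uniform (Hausdorff) topological group. Then the following are equivalent: (1) $G$ is uniformly NSS; (2) $G$ is metrizable and the metric nonstandard hull of $G$ is uniformly NSS; (3) $G$ is metrizable and the metric nonstandard hull of $G$ is NSS; (4) $G$ is metrizable and every nonstandard hull of $G$ is NSS.
   Context: $X^*$ is the nonstandard extension of $X$ in a fixed sufficiently saturated nonstandard universe; $\mathbb{R}_f\subseteq \mathbb{R}^*$ is the set of finite hyperreals and $\operatorname{st}$ the standard part map. All topological groups are Hausdorff, with identity $e$. Local groups: a local group is a Hausdorff space $H$ with a distinguished element $1$, a continuous product $\Omega_H\to H$ with $\Omega_H\subseteq H\times H$ open, and a continuous inversion $\Lambda_H\to H$ with $\Lambda_H\subseteq H$ open, such that $1\in\Lambda_H$, $\{1\}\times H\subseteq\Omega_H$, $H\times\{1\}\subseteq\Omega_H$, $1x=x1=x$; for $x\in\Lambda_H$, $(x,x^{-1}),(x^{-1},x)\in\Omega_H$ and $xx^{-1}=x^{-1}x=1$; and $(xy)z=x(yz)$ whenever $(x,y),(y,z),(xy,z),(x,yz)\in\Omega_H$. The restriction $H|N$ to a symmetric open neighborhood $N$ of $1$ has underlying space $N$ and product domain $\{(x,y)\in\Omega_H\cap (N\times N): xy\in N\}$. Two local groups are locally isomorphic if they have isomorphic restrictions to symmetric open neighborhoods of the identities. A subgroup of $H$ is a subset $K\ni 1$ with $K\subseteq\Lambda_H$, $K\times K\subseteq\Omega_H$, closed under product and inversion. In $H$, ''$x^n$ is defined'' is given recursively: $x^1$ is always defined, and for $n\ge2$,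 $x^n$ is defined if $x^i$ is defined for all $i<n$ and $(x^i,x^j)\in\Omega_H$ for all $i,j<n$ with $i+j=n$ (and $x^n$ is then the common value of $x^ix^j$). Locally uniform groups: for a symmetric open neighborhood $U$ of $e$ in $G$, $G$ is $U$-locally uniform if there is a uniformity on $G$ compatible with the topology such that $(x,y)\mapsto xy: U^2\times U^2\to U^4$ is uniformly continuous, where $U^n=\{x_1\cdots x_n: x_i\in U\}$. $G$ is locally uniform if it is $U$-locally uniform for some such $U$. Nonstandard hulls: let $\mu=\bigcap\{O^*: O \text{ an open neighborhood of } e\}$; for $x,y\in G^*$ write $x\approx_l y$ iff $x^{-1}y\in\mu$, and $\mu(x)=\{y\in G^*: x\approx_l y\}$. The left uniformity $\mathcal{U}_l$ has as a basis the sets $\{(x,y): x^{-1}y\in O\}$, $O$ an open neighborhood of $e$. Let $P_l$ be the set of continuous left-invariant pseudometrics on $G$. Suppose $G$ is $U$-locally uniform and $S\subseteq P_l$ generates $\mathcal{U}_l$ and is closed under finite maxima. Put $\operatorname{in}(U^* )=\{x\in U^*:\mu(x)\subseteq U^*\}$, $U_{S,f}=\{x\in \operatorname{in}(U^* ): p(x,e)\in\mathbb{R}_f \text{ for all } p\in S\}$, $[x]$ the $\approx_l$-class of $x$, and $\hat U_S=\{[x]:x\in U_{S,f}\}$, with the uniformity generated by the pseudometrics ${}^\circ p([x],[y])=\operatorname{st}(p(x,y))$, $p\in S$. With product domain $\Omega=\{([x],[y]): xy\in U_{S,f}\}$, product $[x][y]=[xy]$, inversion $[x]^{-1}=[x^{-1}]$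 (everywhere defined) and identity $[e]$, $\hat U_S$ is a local group. The local groups $\hat U_S$ are called the nonstandard hulls of $G$. If $G$ is metrizable with compatible left-invariant metric $d$, and $U=\{x: d(x,e)<r\}$ is a ball for which $G$ is $U$-locally uniform, then $\hat U_d:=\hat U_{\{d\}}$ is called a metric nonstandard hull; any two metric nonstandard hulls are locally isomorphic, so one speaks of ''the metric nonstandard hull'' (NSS and uniform NSS are invariant under local isomorphism). NSS: a (local) group is NSS if some neighborhood of the identity contains no subgroup other than the trivial one. A topological group $G$ is uniformly NSS (UNSS) if there is a neighborhood $U$ of $e$ such that for every neighborhood $V$ of $e$ there is $n_V\in\mathbb{N}$ such that for all $x\in G$, $x\notin V$ implies $x^n\notin U$ for some $1\le n\le n_V$. A local group $H$ is uniformly NSS if there is a neighborhood $U$ of $1$ in $H$ such that for every neighborhood $V$ of $1$ there is $n_V\in\mathbb{N}$ such that for all $x\in H$, if $x\notin V$ and $x^{n_V}$ is defined, then $x^i\notin U$ for some $i\in\{1,\dots,n_V\}$. *)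

(* Defs.v *)
From HB Require Import structures.
From mathcomp Require Import all_boot all_order all_algebra.
From mathcomp Require Import all_classical all_reals topology normedtype.
From mathcomp Require Import lra zify.
Set Implicit Arguments.
Unset Strict Implicit.
Unset Printing Implicit Defensive.
Import Order.TTheory GRing.Theory Num.Theory.
Import numFieldNormedType.Exports.
Local Open Scope classical_set_scope.
Local Open Scope ring_scope.

(* A nonstandard universe, presented by its action on types (X |-> X^* ) and
   functions (f |-> f^* ): a functor that preserves finite products and the
   two-element type.  Every superstructure embedding satisfying the transfer
   principle restricts to such a functor, every (limit) ultrapower is one, and
   conversely these laws give transfer for all first-order formulas: see
   [star_setC], [star_setI], [star_preimage], [star_eq] and [star_ex] below. *)
Record nonstandard_universe := NonstandardUniverse {
  star : Type -> Type;
  std : forall X, X -> star X;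
  smap : forall X Y, (X -> Y) -> star X -> star Y;
  spair : forall X Y, star X -> star Y -> star (X * Y);
  smap_id : forall X (x : star X), smap id x = x;
  smap_comp : forall X Y Z (f : X -> Y) (g : Y -> Z) (x : star X),
    smap (g \o f) x = smap g (smap f x);
  smap_std : forall X Y (f : X -> Y) (x : X), smap f (std x) = std (f x);
  smap_fst : forall X Y (x : star X) (y : star Y), smap fst (spair x y) = x;
  smap_snd : forall X Y (x : star X) (y : star Y), smap snd (spair x y) = y;
  spair_eta : forall X Y (z : star (X * Y)),
    spair (smap fst z) (smap snd z) = z;
  star_unit : forall x : star unit, x = std tt;
  star_bool : forall b : star bool, b = std true \/ b = std false;
  std_true_false : std true <> std false }.

Arguments std {n X}.
Arguments smap {n X Y}.
Arguments spair {n X Y}.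

Section Transfer.
Variable N : nonstandard_universe.
Implicit Types (X Y Z : Type).

Definition smap2 X Y Z (f : X -> Y -> Z) (x : star N X) (y : star N Y) :
  star N Z := smap (fun p => f p.1 p.2) (spair x y).

(* [star_set A] is the internal set A^*, a subset of X^*. *)
Definition star_set X (A : set X) : set (star N X) :=
  [set x | smap (fun t => `[< A t >]) x = std true].

(* Membership of x in the internal set A, where A is an element of P(X)^*. *)
Definition star_mem X (x : star N X) (A : star N (set X)) : Prop :=
  star_set [set p : X * set X | p.2 p.1] (spair x A).

Lemma smap_const X Y (y : Y) (x : star N X) : smap (fun=> y) x = std y.
Proof.
have -> : (fun _ : X => y) = (fun _ : unit => y) \o (fun _ : X => tt) by [].
by rewrite smap_comp (star_unit (smap _ x)) smap_std.
Qed.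

Lemma spairE X Y Z (f : Z -> X) (g : Z -> Y) (z : star N Z) :
  spair (smap f z) (smap g z) = smap (fun t => (f t, g t)) z.
Proof.
rewrite -[RHS]spair_eta -!smap_comp; congr (spair (smap _ z) (smap _ z)).
Qed.

Lemma smap2E X Y Z W (h : X -> Y -> W) (f : Z -> X) (g : Z -> Y) z :
  smap2 h (smap f z) (smap g z) = smap (fun t => h (f t) (g t)) z.
Proof. by rewrite /smap2 spairE -smap_comp. Qed.

Lemma star_preimage X Y (f : X -> Y) (A : set Y) (x : star N X) :
  star_set A (smap f x) <-> star_set (f @^-1` A) x.
Proof. by rewrite /star_set /= -smap_comp. Qed.

Lemma star_std X (A : set X) (x : X) : star_set A (std x) <-> A x.
Proof.
rewrite /star_set /= smap_std; split=> [|Ax]; last by rewrite asboolT.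
by case: asboolP => // _ e; case: (@std_true_false N).
Qed.

Lemma star_setT X (x : star N X) : star_set setT x.
Proof.
rewrite /star_set /= -(smap_const true x); congr smap.
by apply/funext => t; rewrite asboolT.
Qed.

Lemma star_setC X (A : set X) (x : star N X) :
  star_set (~` A) x <-> ~ star_set A x.
Proof.
rewrite /star_set /=.
have -> : (fun t => `[< (~` A) t >]) = negb \o (fun t => `[< A t >]).
  by apply/funext => t; rewrite /= asbool_neg.
rewrite smap_comp; case: (star_bool (smap (fun t => `[< A t >]) x)) => ->.
  rewrite smap_std /=; split=> [/esym|]; last by [].
  by move=> e; case: (@std_true_false N).
by rewrite smap_std /=; split=> // _ /esym/(@std_true_false N).
Qed.

Lemma star_setI X (A B : set X) (x : star N X) :
  star_set (A `&` B) x <-> star_set A x /\ star_set B x.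
Proof.
rewrite /star_set /=.
have -> : smap (fun t => `[< (A `&` B) t >]) x =
    smap2 andb (smap (fun t => `[< A t >]) x) (smap (fun t => `[< B t >]) x).
  rewrite smap2E; congr smap; apply/funext => t.
  by rewrite -asbool_and.
have tf := @std_true_false N.
have E (a b : bool) : smap2 andb (@std N _ a) (std b) = std (a && b).
  rewrite -(smap_const a x) -(smap_const b x) smap2E.
  by rewrite (smap_const (a && b)).
case: (star_bool (smap (fun t => `[< A t >]) x)) => ->;
case: (star_bool (smap (fun t => `[< B t >]) x)) => ->; rewrite E /=;
by split=> [e|[e1 e2]] //; case: (tf); rewrite ?e ?e1 ?e2.
Qed.

Lemma star_subset X (A B : set X) (x : star N X) :
  A `<=` B -> star_set A x -> star_set B x.
Proof.
move=> AB Ax; apply: contrapT => /star_setC Bx.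
have /star_setI : star_set A x /\ star_set (~` B) x by [].
suff -> : A `&` ~` B = ~` setT by move/star_setC; apply; exact: star_setT.
by rewrite setCT -subset0 => t [/AB].
Qed.

Lemma star_eq X Y (f g : X -> Y) (x : star N X) :
  star_set [set t | f t = g t] x <-> smap f x = smap g x.
Proof.
rewrite /star_set /=; split=> [h|fg].
  pose k (t : X) (b : bool) := if b then f t else g t.
  have kE (c : X -> bool) : smap (fun t => k t (c t)) x =
      smap2 k (smap id x) (smap c x) by rewrite smap2E.
  have -> : f = fun t => k t true by [].
  have -> : g = fun t => k t `[< f t = g t >].
    by apply/funext => t; rewrite /k; case: asboolP.
  by rewrite !kE h smap_const.
have -> : (fun t => `[< f t = g t >]) =
    (fun p : Y * Y => `[< p.1 = p.2 >]) \o (fun t => (f t, g t)) by [].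
rewrite smap_comp -spairE fg spairE -smap_comp -(smap_const true x).
by congr smap; apply/funext => t /=; rewrite asboolT.
Qed.

Lemma star_ex X Y (A : set (X * Y)) (x : star N X) :
  star_set [set t | exists u, A (t, u)] x <->
  exists y : star N Y, star_set A (spair x y).
Proof.
split=> [h|[y]]; last first.
  rewrite -{2}(smap_fst x y) star_preimage; apply: star_subset => -[t u] /= Atu.
  by exists u.
have [[y0]|nY] := pselect (exists y : Y, True).
  have [f hf] : {f : X -> Y & forall t, (exists u, A (t, u)) -> A (t, f t)}.
    apply: (@choice _ _ (fun t y => (exists u, A (t, u)) -> A (t, y))) => t.
    by have [[u Atu]|nA] := pselect (exists u, A (t, u)); [exists u|exists y0].
  exists (smap f x); rewrite -{1}(smap_id x) spairE star_preimage.
  by apply: star_subset h => t /hf.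
have := h; have -> : [set t : X | exists u, A (t, u)] = ~` setT.
  by rewrite setCT -subset0 => t [u _]; case: nY; exists u.
by move/star_setC; case; exact: star_setT.
Qed.

Lemma std_inj X : injective (@std N X).
Proof.
move=> x y xy; have := star_std [set y] x.
by rewrite xy star_std => -[/(_ erefl)].
Qed.

Lemma star_common2 X Y (x : star N X) (y : star N Y) :
  exists (z : star N (X * Y)), x = smap fst z /\ y = smap snd z.
Proof. by exists (spair x y); rewrite smap_fst smap_snd. Qed.

Lemma star_common3 X Y Z (x : star N X) (y : star N Y) (z : star N Z) :
  exists t : star N (X * Y * Z), [/\ x = smap (fun p => p.1.1) t,
    y = smap (fun p => p.1.2) t & z = smap snd t].
Proof.
have [u [-> ->]] := star_common2 x y; have [t [-> ->]] := star_common2 u z.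
by exists t; rewrite -!smap_comp.
Qed.

Lemma star_common4 X Y Z W (x : star N X) (y : star N Y) (z : star N Z)
  (w : star N W) : exists t : star N (X * Y * Z * W),
  [/\ x = smap (fun p => p.1.1.1) t, y = smap (fun p => p.1.1.2) t,
      z = smap (fun p => p.1.2) t & w = smap snd t].
Proof.
have [u [-> -> ->]] := star_common3 x y z.
have [t [-> ->]] := star_common2 u w.
by exists t; rewrite -!smap_comp.
Qed.

End Transfer.

(* K-saturation: a K-indexed family of internal sets with the finite
   intersection property has nonempty intersection. *)
Definition saturated (N : nonstandard_universe) (K : Type) : Prop :=
  forall (X : Type) (A : K -> star N (set X)),
    (forall n (k : 'I_n -> K), exists x, forall i, star_mem x (A (k i))) ->
    exists x, forall k, star_mem x (A k).

HB.mixin Record isTopologicalGroup G of Group G & Topological G := {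
  mulg_continuous : continuous (fun xy : G * G => (xy.1 * xy.2)%g);
  invg_continuous : continuous (fun x : G => (x^-1)%g) }.

#[short(type="topologicalGroupType")]
HB.structure Definition TopologicalGroup :=
  {G of isTopologicalGroup G & Group G & Topological G}.

(* E is (the set of entourages of) a uniformity inducing the topology of T. *)
Definition compatible_uniformity (T : topologicalType)
    (E : set_system (T * T)) : Prop :=
  [/\ Filter E,
      forall A, E A -> diagonal `<=` A,
      forall A, E A -> E (A^-1)%relation,
      forall A, E A -> exists2 B, E B & (B \; B)%relation `<=` A &
      forall x : T, nbhs x = nbhs_ E x].

Section LocallyUniform.
Variable G : topologicalGroupType.

Definition symmetric_open_nbhs (U : set G) : Prop :=
  [/\ open U, U 1%g & forall x, U x -> U (x^-1)%g].

(* Uniform continuity is with respect to the product uniformity on U^2 x U^2. *)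
Definition locally_uniform_at (U : set G) : Prop :=
  symmetric_open_nbhs U /\
  exists2 E : set_system (G * G), compatible_uniformity E &
    let U2 := [set (x * y)%g | x in U & y in U] in
    forall A, E A -> exists2 B, E B &
      forall x x' y y', U2 x -> U2 x' -> U2 y -> U2 y' ->
        B (x, x') -> B (y, y') -> A ((x * y)%g, (x' * y')%g).

Definition locally_uniform : Prop := exists U, locally_uniform_at U.

Definition uniformly_NSS_group : Prop :=
  exists2 U, nbhs (1%g : G) U & forall V, nbhs (1%g : G) V ->
    exists n : nat, forall x : G, ~ V x ->
      exists2 i : nat, (1 <= i <= n)%N & ~ U (x ^+ i)%g.

Definition left_uniformity : set_system (G * G) :=
  filter_from (open_nbhs (1%g : G))
    (fun O => [set xy | O (xy.1^-1 * xy.2)%g]).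

Lemma nbhs1_mulr (x : G) (O : set G) :
  nbhs (1%g : G) O <-> nbhs x [set y | O (x^-1 * y)%g].
Proof.
have c (a b : G) (A : set G) : nbhs (a * b)%g A -> nbhs b [set y | A (a * y)%g].
  move=> nA; have /= := @mulg_continuous G (a, b) A nA.
  move=> [[B C] /= [nB nC] BC]; apply: filterS nC => y Cy.
  by apply: (BC (a, y)); split=> //=; exact: nbhs_singleton.
split=> nO.
  by apply: (c x^-1%g); rewrite mulVg.
have := c x 1%g _; rewrite mulg1 => /(_ _ nO); apply: filterS => y /=.
by rewrite mulKg.
Qed.

Lemma locally_uniform_conj (U : set G) : locally_uniform_at U ->
  forall O, nbhs (1%g : G) O -> exists2 O', nbhs (1%g : G) O' &
    forall y e, U y -> O' e -> O (y^-1 * e * y)%g.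
Proof.
move=> [[oU U1 Us] [E [EF Er Ei Es Ec] uc]] O nO.
have nU : nbhs (1%g : G) U by apply: open_nbhs_nbhs.
have inU2 x : U x -> [set (x * y)%g | x in U & y in U] x.
  by move=> Ux; exists x => //; exists 1%g => //; rewrite mulg1.
rewrite Ec in nO; move: nO => [A EA AO].
have [B EB BA] := uc _ EA; have [C EC CB] := uc _ EB.
have nC : nbhs (1%g : G) (xsection C 1%g) by rewrite Ec; exists C.
exists (U `&` xsection C 1%g).
  by apply: filterI.
move=> y e Uy [Ue /set_mem Ce]; rewrite -mulgA; apply: AO; apply/mem_set.
have := @BA (y^-1)%g (y^-1)%g y (e * y)%g; rewrite mulVg; apply.
- exact/inU2/Us.
- exact/inU2/Us.
- exact: inU2.
- by exists e => //; exists y.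
- exact: (Er _ EB (_, _)).
- rewrite -[X in B (X, _)]mul1g; apply: CB => //; do ?exact: inU2.
  exact: (Er _ EC (_, _)).
Qed.

End LocallyUniform.

Arguments left_uniformity G : clear implicits.

Section Pseudometrics.
Variable R : realType.

Definition pseudometric (T : Type) (p : T -> T -> R) : Prop :=
  [/\ forall x, p x x = 0, forall x y, p x y = p y x &
      forall y x z, p x z <= p x y + p y z].

Lemma pseudometric_ge0 T (p : T -> T -> R) x y : pseudometric p -> 0 <= p x y.
Proof. by move=> [p0 ps pt]; have := pt y x x; rewrite p0 (ps y x) => ?; lra. Qed.

(* The uniformity generated by a set P of pseudometrics. *)
Definition generated_uniformity (T : Type) (P : set (T -> T -> R)) :
    set_system (T * T) :=
  smallest (@Filter _) [set A | exists p e,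
    [/\ P p, 0 < e & A = [set xy | p xy.1 xy.2 < e]]].

Definition closed_under_max (T : Type) (P : set (T -> T -> R)) : Prop :=
  forall p q, P p -> P q -> P (fun x y => Num.max (p x y) (q x y)).

Definition compatible_metric (T : topologicalType) (d : T -> T -> R) : Prop :=
  [/\ pseudometric d, forall x y, d x y = 0 -> x = y &
      forall x, nbhs x = filter_from [set r | 0 < r]
        (fun r => [set y | d x y < r])].

Definition metrizable (T : topologicalType) : Prop :=
  exists d : T -> T -> R, compatible_metric d.

Definition left_invariant (G : groupType) (p : G -> G -> R) : Prop :=
  forall z x y, p (z * x)%g (z * y)%g = p x y.

(* The set P_l. *)
Definition left_pseudometrics (G : topologicalGroupType) :
    set (G -> G -> R) :=
  [set p | [/\ pseudometric p, left_invariant p &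
               continuous (fun xy : G * G => p xy.1 xy.2)]].

Section Generated.
Variables (T : Type) (P : set (T -> T -> R)).

Lemma generated_uniformity_ball p e : P p -> 0 < e ->
  generated_uniformity P [set xy | p xy.1 xy.2 < e].
Proof. by move=> Pp e0; apply: sub_gen_smallest; exists p, e. Qed.

Lemma generated_uniformity_ind (Q : set_system (T * T)) : Filter Q ->
  (forall p e, P p -> 0 < e -> Q [set xy | p xy.1 xy.2 < e]) ->
  forall A, generated_uniformity P A -> Q A.
Proof.
move=> FQ h; apply: smallest_sub => // _ [p [e [Pp e0 ->]]]; exact: h.
Qed.

Lemma generated_uniformity_max : closed_under_max P ->
  forall A, generated_uniformity P A ->
  A = setT \/
  exists p e, [/\ P p, 0 < e & [set xy | p xy.1 xy.2 < e] `<=` A].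
Proof.
move=> Pm; apply: generated_uniformity_ind; last first.
  by move=> p e Pp e0; right; exists p, e; split.
split; first by left.
- move=> A B [->|[p [e [Pp e0 pA]]]]; first by rewrite setTI.
  move=> [->|[q [f [Pq f0 qB]]]]; first by rewrite setIT; right; exists p, e.
  right; exists (fun x y => Num.max (p x y) (q x y)), (Num.min e f).
  split; [exact: Pm|by rewrite lt_min e0|].
  move=> [x y] /=; rewrite lt_min !gt_max => /andP[/andP[pe _] /andP[_ qf]].
  by split; [apply: pA|apply: qB].
- move=> A B AB [A_T|[p [e [Pp e0 pA]]]].
    by left; rewrite -subTset -A_T.
  by right; exists p, e; split=> //; apply: subset_trans AB.
Qed.

Hypothesis Pps : forall p, P p -> pseudometric p.

Lemma generated_uniformity_filter : Filter (generated_uniformity P).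
Proof. exact: smallest_filter_filter. Qed.

Lemma generated_uniformity_refl A :
  generated_uniformity P A -> diagonal `<=` A.
Proof.
move: A; apply: generated_uniformity_ind => p e /Pps[p0 _ _] e0 [x y].
by rewrite /diagonal/= => ->; rewrite p0.
Qed.

Lemma generated_uniformity_inv A :
  generated_uniformity P A -> generated_uniformity P (A^-1)%relation.
Proof.
have FG := generated_uniformity_filter.
move: A; apply: generated_uniformity_ind; last first.
  move=> p e Pp e0; have [_ ps _] := Pps Pp.
  apply: (@filterS _ _ FG) (generated_uniformity_ball Pp e0) => -[x y] /=.
  by rewrite ps.
split; first exact: (@filterT _ _ FG).
- by move=> A B; exact: (@filterI _ _ FG).
- by move=> A B AB; apply: (@filterS _ _ FG) => -[x y]; apply: AB.
Qed.

Lemma generated_uniformity_split A : generated_uniformity P A ->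
  exists2 B, generated_uniformity P B & (B \; B)%relation `<=` A.
Proof.
have FG := generated_uniformity_filter.
move: A; apply: generated_uniformity_ind; last first.
  move=> p e Pp e0; have [_ _ pt] := Pps Pp.
  exists [set xy | p xy.1 xy.2 < e / 2].
    by apply: generated_uniformity_ball => //; rewrite divr_gt0.
  move=> [x z] /= [y /= h1 h2].
  by have ? := pt y x z; lra.
split; first by exists setT => //; exact: (@filterT _ _ FG).
- move=> A B [C gC CA] [D gD DB]; exists (C `&` D); first exact: (@filterI _ _ FG).
  move=> [x z] /= [y [C1 D1] [C2 D2]].
  by split; [apply: CA|apply: DB]; exists y.
- by move=> A B AB [C gC CA]; exists C => //; apply: subset_trans AB.
Qed.

End Generated.
End Pseudometrics.

Arguments left_pseudometrics R G : clear implicits.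

(* The partial operations are total functions that are only meaningful on
   their domains lg_dom (the set Omega_H) and lg_invdom (the set Lambda_H). *)
Record local_group := LocalGroup {
  lg_sort :> topologicalType;
  lg_one : lg_sort;
  lg_dom : set (lg_sort * lg_sort);
  lg_mul : lg_sort -> lg_sort -> lg_sort;
  lg_invdom : set lg_sort;
  lg_inv : lg_sort -> lg_sort;
  lg_hausdorff : hausdorff_space lg_sort;
  lg_dom_open : open lg_dom;
  lg_mul_continuous :
    {within lg_dom, continuous (fun xy => lg_mul xy.1 xy.2)};
  lg_invdom_open : open lg_invdom;
  lg_inv_continuous : {within lg_invdom, continuous lg_inv};
  lg_invdom1 : lg_invdom lg_one;
  lg_dom1x : forall x, lg_dom (lg_one, x);
  lg_domx1 : forall x, lg_dom (x, lg_one);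
  lg_mul1x : forall x, lg_mul lg_one x = x;
  lg_mulx1 : forall x, lg_mul x lg_one = x;
  lg_domxV : forall x, lg_invdom x -> lg_dom (x, lg_inv x);
  lg_domVx : forall x, lg_invdom x -> lg_dom (lg_inv x, x);
  lg_mulxV : forall x, lg_invdom x -> lg_mul x (lg_inv x) = lg_one;
  lg_mulVx : forall x, lg_invdom x -> lg_mul (lg_inv x) x = lg_one;
  lg_mulA : forall x y z, lg_dom (x, y) -> lg_dom (y, z) ->
    lg_dom (lg_mul x y, z) -> lg_dom (x, lg_mul y z) ->
    lg_mul (lg_mul x y) z = lg_mul x (lg_mul y z) }.

Section LocalGroupTheory.
Variable H : local_group.

Definition lg_subgroup (K : set H) : Prop :=
  [/\ K (lg_one H), K `<=` @lg_invdom H, K `*` K `<=` @lg_dom H,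
      forall x y, K x -> K y -> K (lg_mul x y) &
      forall x, K x -> K (lg_inv x)].

Definition NSS : Prop :=
  exists2 V, nbhs (lg_one H) V &
    forall K, lg_subgroup K -> K `<=` V -> K = [set lg_one H].

(* lg_pow x n is x^n, only meaningful when x^n is defined. *)
Fixpoint lg_pow (x : H) (n : nat) : H :=
  match n with
  | 0 => lg_one H
  | 1 => x
  | m.+1 => lg_mul (lg_pow x m) x
  end.

(* "x^n is defined", with the recursion on n unfolded: see [pow_definedE] for
   the recursive form and [lg_powD] for the common value. *)
Definition pow_defined (x : H) (n : nat) : Prop :=
  forall i j, (0 < i)%N -> (0 < j)%N -> (i + j <= n)%N ->
    lg_dom (lg_pow x i, lg_pow x j).

Lemma pow_defined1 x : pow_defined x 1.
Proof. by case=> [|i] [|j] //; rewrite addSn addnS. Qed.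

Lemma pow_definedE x n : (2 <= n)%N -> pow_defined x n <->
  (forall i, (0 < i < n)%N -> pow_defined x i) /\
  (forall i j, (i < n)%N -> (j < n)%N -> (i + j = n)%N ->
     lg_dom (lg_pow x i, lg_pow x j)).
Proof.
move=> n2; split=> [h|[h1 h2] i j i0 j0].
  split=> [i /andP[i0 ltin] k l k0 l0 kl|i j ltin ltjn ijn].
    by apply: h => //; apply: leq_trans kl (ltnW _).
  by apply: h; lia.
rewrite leq_eqVlt => /orP[/eqP ijn|ltijn].
  by apply: h2 => //; lia.
by apply: (h1 (i + j)%N) => //; lia.
Qed.

Lemma lg_powD x i j : (0 < i)%N -> (0 < j)%N -> pow_defined x (i + j) ->
  lg_mul (lg_pow x i) (lg_pow x j) = lg_pow x (i + j).
Proof.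
have powS n : (0 < n)%N -> lg_pow x n.+1 = lg_mul (lg_pow x n) x by case: n.
move=> i0; elim: j => // -[|j] IH _ h.
  by rewrite addn1 (powS i).
have hj : pow_defined x (i + j.+1).
  by move=> k l k0 l0 kl; apply: h => //; rewrite addnS ltnW.
have E := IH isT hj.
have lt0 : (0 < i + j.+1)%N by lia.
rewrite addnS (powS _ lt0) -E (powS j.+1)// lg_mulA//.
- exact: hj.
- by apply: (h j.+1 1%N) => //; lia.
- by rewrite E; apply: (h (i + j.+1)%N 1%N) => //; lia.
- by rewrite -powS//; exact: h.
Qed.

(* The bound n_V is a positive integer, "x^n is defined" being only given a
   meaning for n >= 1. *)
Definition uniformly_NSS : Prop :=
  exists2 U, nbhs (lg_one H) U & forall V, nbhs (lg_one H) V ->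
    exists2 n : nat, (0 < n)%N & forall x : H, ~ V x -> pow_defined x n ->
      exists2 i : nat, (1 <= i <= n)%N & ~ U (lg_pow x i).

End LocalGroupTheory.

Section Hyperreals.
Variables (N : nonstandard_universe) (R : realType).

Definition finite_hyperreal (x : star N R) : Prop :=
  exists c : R, star_set [set t | `|t| <= c] x.

(* The standard part map, only meaningful on finite hyperreals: see [stP]. *)
Definition st (x : star N R) : R :=
  xget 0 [set r | forall e, 0 < e -> star_set [set t | `|t - r| < e] x].

Lemma finite_dom Z (z : star N Z) (f g h : Z -> R) :
  finite_hyperreal (smap f z) -> finite_hyperreal (smap g z) ->
  (forall t, `|h t| <= `|f t| + `|g t|) -> finite_hyperreal (smap h z).
Proof.
move=> [c /star_preimage fc] [d /star_preimage gd] hfg.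
exists (c + d); apply/star_preimage.
have /star_setI := conj fc gd; apply: star_subset => t [/= ft gt].
exact: le_trans (hfg t) (lerD ft gt).
Qed.

Lemma stP (x : star N R) : finite_hyperreal x ->
  forall e, 0 < e -> star_set [set t | `|t - st x| < e] x.
Proof.
move=> [c xc].
pose P := [set r : R | forall e, 0 < e -> star_set [set t | `|t - r| < e] x].
suff [r Pr] : exists r, P r by exact: (@xgetPex _ 0 P (ex_intro _ r Pr)).
pose A := [set r : R | star_set [set t | r <= t] x].
have Ac r : A r -> r <= c.
  move=> Ar; have /star_setI := conj Ar xc.
  rewrite leNgt => h; apply/negP => cr; move: h.
  suff -> : [set t | r <= t] `&` [set t | `|t| <= c] = ~` setT.
    by move/star_setC; apply; exact: star_setT.
  rewrite setCT -subset0 => t [/= rt]; rewrite ler_norml => /andP[_ tc].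
  by have := lt_le_trans cr (le_trans rt tc); rewrite ltxx.
have An : A (- c).
  by apply: star_subset xc => t /=; rewrite ler_norml => /andP[].
have sA : has_sup A by split; [exists (- c)|exists c => r /Ac].
exists (sup A) => e e0.
have [r Ar er] := sup_adherent e0 sA.
have nA : ~ A (sup A + e / 2).
  by move=> /(sup_upper_bound sA) h; lra.
have /star_setI := conj Ar ((star_setC _ _).2 nA).
apply: star_subset => t [/= rt /negP]; rewrite -ltNge => tl.
rewrite ltr_norml; apply/andP; split; first by lra.
by lra.
Qed.

Lemma st_unique (x : star N R) r :
  (forall e, 0 < e -> star_set [set t | `|t - r| < e] x) -> st x = r.
Proof.
move=> hr; have fx : finite_hyperreal x.
  exists (`|r| + 1); apply: star_subset (hr 1 ltr01) => t /= h.
  rewrite -[t](subrK r) (le_trans (ler_normD _ _))// addrC lerD2l.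
  exact: ltW.
apply/eqP; rewrite -subr_eq0 -normr_le0 leNgt; apply/negP => h.
have e0 : 0 < `|st x - r| / 2 by rewrite divr_gt0.
have /star_setI := conj (stP fx e0) (hr _ e0).
set B := _ `&` _; suff -> : B = ~` setT.
  by move/star_setC; apply; exact: star_setT.
rewrite setCT -subset0 => t [/= h1 h2].
have := ler_distD t (st x) r; rewrite (distrC (st x) t) => h3; lra.
Qed.

Lemma st_std (r : R) : st (std r) = r.
Proof. by apply: st_unique => e e0; apply/star_std; rewrite /= subrr normr0. Qed.

Lemma stD Z (z : star N Z) (f g : Z -> R) :
  finite_hyperreal (smap f z) -> finite_hyperreal (smap g z) ->
  st (smap (fun t => f t + g t) z) = st (smap f z) + st (smap g z).
Proof.
move=> Ff Fg; apply: st_unique => e e0.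
have e2 : 0 < e / 2 by rewrite divr_gt0.
have /star_preimage hf := stP Ff e2; have /star_preimage hg := stP Fg e2.
apply/star_preimage.
have /star_setI := conj hf hg; apply: star_subset => t [/= h1 h2].
rewrite opprD addrACA (le_lt_trans (ler_normD _ _))// [e]splitr ltrD//.
Qed.

Lemma st_lt (x : star N R) e :
  finite_hyperreal x -> st x < e -> star_set [set t | t < e] x.
Proof.
move=> fx h; have h0 : 0 < e - st x by lra.
by apply: star_subset (stP fx h0) => t /=; rewrite ltr_norml => /andP[h1 h2]; lra.
Qed.

Lemma st_leP (x : star N R) e :
  finite_hyperreal x -> star_set [set t | t <= e] x -> st x <= e.
Proof.
move=> fx h; rewrite leNgt; apply/negP => h0.
have h1 : 0 < st x - e by lra.
have /star_setI := conj h (stP fx h1).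
set B := _ `&` _; suff -> : B = ~` setT.
  by move/star_setC; apply; exact: star_setT.
by rewrite setCT -subset0 => t [/= h2]; rewrite ltr_norml => /andP[h3 h4]; lra.
Qed.

Lemma st_ge0 (x : star N R) :
  finite_hyperreal x -> star_set [set t | 0 <= t] x -> 0 <= st x.
Proof.
move=> fx h; rewrite leNgt; apply/negP => h0.
have /star_setI := conj h (st_lt fx h0).
set B := _ `&` _; suff -> : B = ~` setT.
  by move/star_setC; apply; exact: star_setT.
by rewrite setCT -subset0 => t [/= h2 h3]; lra.
Qed.

Lemma st_le Z (z : star N Z) (f g : Z -> R) :
  finite_hyperreal (smap f z) -> finite_hyperreal (smap g z) ->
  (forall t, f t <= g t) -> st (smap f z) <= st (smap g z).
Proof.
move=> Ff Fg fg; rewrite leNgt; apply/negP => h.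
have e0 : 0 < (st (smap f z) - st (smap g z)) / 2 by lra.
have /star_preimage hf := stP Ff e0; have /star_preimage hg := stP Fg e0.
have /star_setI := conj hf hg.
set B := _ `&` _; suff -> : B = ~` setT.
  by move/star_setC; apply; exact: star_setT.
rewrite setCT -subset0 => t [/=]; have h1 := fg t.
by rewrite !ltr_norml => /andP[h2 h3] /andP[h4 h5]; lra.
Qed.

End Hyperreals.

Section StarGroup.
Variable N : nonstandard_universe.

HB.instance Definition _ (X : Type) := gen_eqMixin (star N X).
HB.instance Definition _ (X : Type) := gen_choiceMixin (star N X).

Variable G : groupType.

Let smul (x y : star N G) : star N G := smap2 (fun a b : G => (a * b)%g) x y.
Let sinv (x : star N G) : star N G := smap (fun a : G => (a^-1)%g) x.
Let sone : star N G := std (1%g : G).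

Let smulA : associative smul.
Proof.
move=> x y z; have [t [-> -> ->]] := star_common3 x y z.
rewrite /smul !smap2E; congr smap; apply/funext => -[[a b] c] /=.
by rewrite mulgA.
Qed.

Let smul1 : left_id sone smul.
Proof.
move=> x; rewrite -[in LHS](smap_id x) /sone -(smap_const 1%g x) /smul smap2E.
rewrite -[RHS](smap_id x); congr smap; apply/funext => a /=; exact: mul1g.
Qed.

Let smulx1 : right_id sone smul.
Proof.
move=> x; rewrite -[in LHS](smap_id x) /sone -(smap_const 1%g x) /smul smap2E.
rewrite -[RHS](smap_id x); congr smap; apply/funext => a /=; exact: mulg1.
Qed.

Let smulV : left_inverse sone sinv smul.
Proof.
move=> x; rewrite -{2}(smap_id x) /sone -(smap_const 1%g x) /smul smap2E.
congr smap; apply/funext => a /=; exact: mulVg.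
Qed.

Let smulxV : right_inverse sone sinv smul.
Proof.
move=> x; rewrite -{1}(smap_id x) /sone -(smap_const 1%g x) /smul smap2E.
congr smap; apply/funext => a /=; exact: mulgV.
Qed.

(* The group G^*, with the extensions of the operations of G. *)
HB.instance Definition _ :=
  isGroup.Build (star N G) smulA smul1 smulx1 smulV smulxV.

Lemma star_mulE (x y : star N G) :
  (x * y)%g = smap2 (fun a b : G => (a * b)%g) x y.
Proof. by []. Qed.

Lemma star_invE (x : star N G) : (x^-1)%g = smap (fun a : G => (a^-1)%g) x.
Proof. by []. Qed.

Lemma star_oneE : (1%g : star N G) = std (1%g : G).
Proof. by []. Qed.

Lemma smapM Z (z : star N Z) (f g : Z -> G) :
  (smap f z * smap g z)%g = smap (fun t => f t * g t)%g z.
Proof. by rewrite star_mulE smap2E. Qed.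

Lemma smapV Z (z : star N Z) (f : Z -> G) :
  ((smap f z)^-1)%g = smap (fun t => (f t)^-1)%g z.
Proof. by rewrite star_invE -smap_comp. Qed.

End StarGroup.

Section Monads.
Variables (N : nonstandard_universe) (R : realType).
Variable G : topologicalGroupType.
Implicit Types x y : star N G.

Definition monad : set (star N G) :=
  \bigcap_(O in open_nbhs (1%g : G)) star_set O.

Definition approx_l x y : Prop := monad (x^-1 * y)%g.

(* The monad mu(x), which is also the equivalence class [x] for approx_l. *)
Definition monad_at x : set (star N G) := [set y | approx_l x y].

(* The set in(U^* ). *)
Definition inner (U : set G) : set (star N G) :=
  [set x | star_set U x /\ monad_at x `<=` star_set U].

(* The set U_{S,f}. *)
Definition finite_part (U : set G) (S : set (G -> G -> R)) :
    set (star N G) :=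
  [set x | inner U x /\
     forall p, S p -> finite_hyperreal (smap2 p x (1%g : star N G))].

Lemma monadP x :
  monad x <-> forall O, nbhs (1%g : G) O -> star_set O x.
Proof.
split=> [mx O|h O /open_nbhs_nbhs /h//].
by rewrite nbhsE => -[V oV VO]; apply: star_subset VO _; exact: mx.
Qed.

Lemma monad1 : monad 1%g.
Proof. by apply/monadP => O nO; apply/star_std; exact: nbhs_singleton. Qed.

Lemma nbhs1_mul (O : set G) : nbhs (1%g : G) O ->
  exists2 O', nbhs (1%g : G) O' & forall a b, O' a -> O' b -> O (a * b)%g.
Proof.
move=> nO; have := @mulg_continuous G (1%g, 1%g) O; rewrite /= mulg1.
move=> /(_ nO) [[B C] /= [nB nC] BC]; exists (B `&` C); first exact: filterI.
by move=> a b [Ba _] [_ Cb]; apply: (BC (a, b)).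
Qed.

Lemma nbhs1_inv (O : set G) : nbhs (1%g : G) O ->
  nbhs (1%g : G) [set a | O (a^-1)%g].
Proof.
by move=> nO; have := @invg_continuous G 1%g O; rewrite /= invg1; apply.
Qed.

Lemma star_setM (A B C : set G) x y :
  (forall a b, A a -> B b -> C (a * b)%g) ->
  star_set A x -> star_set B y -> star_set C (x * y)%g.
Proof.
move=> ABC; have [t [-> ->]] := star_common2 x y.
rewrite smapM => /star_preimage Ax /star_preimage By; apply/star_preimage.
have /star_setI := conj Ax By; apply: star_subset => -[a b] [/= Aa Bb].
exact: ABC.
Qed.

Lemma star_setV (A B : set G) x : (forall a, A a -> B (a^-1)%g) ->
  star_set A x -> star_set B (x^-1)%g.
Proof.
by move=> AB Ax; rewrite star_invE; apply/star_preimage; apply: star_subset Ax.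
Qed.

Lemma monadM x y : monad x -> monad y -> monad (x * y)%g.
Proof.
move=> /monadP mx /monadP my; apply/monadP => O /nbhs1_mul[O' nO' h].
by apply: star_setM h _ _; [exact: mx|exact: my].
Qed.

Lemma monadV x : monad x -> monad (x^-1)%g.
Proof.
move=> /monadP mx; apply/monadP => O /nbhs1_inv/mx; exact: star_setV.
Qed.

Lemma approx_refl x : approx_l x x.
Proof. by rewrite /approx_l mulVg; exact: monad1. Qed.

Lemma approx_sym x y : approx_l x y -> approx_l y x.
Proof. by move=> /monadV; rewrite invgM invgK. Qed.

Lemma approx_trans y x z : approx_l x y -> approx_l y z -> approx_l x z.
Proof. by move=> h /(monadM h); rewrite -mulgA mulVKg. Qed.

Lemma monad_at_eq x y : approx_l x y -> monad_at x = monad_at y.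
Proof.
move=> xy; apply/seteqP; split=> z; apply: approx_trans => //.
exact: approx_sym.
Qed.

Lemma monad_at_approx x y : monad_at x = monad_at y -> approx_l x y.
Proof.
move=> e; have : monad_at y y by exact: approx_refl.
by rewrite -e.
Qed.

Lemma inner_approx U x y : approx_l x y -> inner U x -> inner U y.
Proof.
by move=> xy [Ux mx]; split; [exact: mx|rewrite -(monad_at_eq xy)].
Qed.

Section LocallyUniformMonads.
Variable U : set G.
Hypothesis locU : locally_uniform_at U.

Lemma star_mul_near O : nbhs (1%g : G) O ->
  exists2 O', nbhs (1%g : G) O' & forall x x' y y', star_set U y ->
    star_set O' (x^-1 * x')%g -> star_set O' (y^-1 * y')%g ->
    star_set O ((x * y)^-1 * (x' * y'))%g.
Proof.
move=> /nbhs1_mul[O1 nO1 h1]; have [O2 nO2 h2] := locally_uniform_conj locU nO1.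
exists (O1 `&` O2); first exact: filterI.
move=> x x' y y' Uy /star_setI[_ xx'] /star_setI[yy' _].
have E : ((x * y)^-1 * (x' * y') =
          y^-1 * (x^-1 * x') * y * (y^-1 * y'))%g.
  by rewrite invgM !mulgA mulgK.
rewrite E; apply: star_setM h1 _ yy'.
move: Uy xx'; move: (x^-1 * x')%g => e.
have [t [-> ->]] := star_common2 y e.
rewrite smapV !smapM => /star_preimage Uy /star_preimage Oe.
apply/star_preimage; have /star_setI := conj Uy Oe.
by apply: star_subset => -[a b] [/= Ua Ob]; exact: h2.
Qed.

Lemma star_inv_near O : nbhs (1%g : G) O ->
  exists2 O', nbhs (1%g : G) O' & forall x x', star_set U x ->
    star_set O' (x^-1 * x')%g -> star_set O ((x^-1)^-1 * x'^-1)%g.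
Proof.
move=> nO; have [O2 nO2 h2] := locally_uniform_conj locU nO.
have Us : forall a, U a -> U (a^-1)%g by case: locU => -[].
exists [set a | O2 (a^-1)%g]; first exact: nbhs1_inv.
move=> x x'.
have [t [-> ->]] := star_common2 x x'.
rewrite !smapV !smapM => /star_preimage Ux /star_preimage Oe.
apply/star_preimage; have /star_setI := conj Ux Oe.
apply: star_subset => -[a b] [/= Ua].
rewrite invgM invgK => Ob; have := h2 _ _ (Us _ Ua) Ob.
by rewrite invgK !mulgA mulgK.
Qed.

Lemma approx_mul x x' y y' : star_set U y ->
  approx_l x x' -> approx_l y y' -> approx_l (x * y)%g (x' * y')%g.
Proof.
move=> Uy /monadP xx' /monadP yy'; apply/monadP => O nO.
have [O' nO' h] := star_mul_near nO.
by apply: h => //; [exact: xx'|exact: yy'].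
Qed.

Lemma approx_inv x x' : star_set U x ->
  approx_l x x' -> approx_l (x^-1)%g (x'^-1)%g.
Proof.
move=> Ux /monadP xx'; apply/monadP => O nO.
by have [O' nO' h] := star_inv_near nO; apply: h => //; exact: xx'.
Qed.

Lemma inner_inv x : inner U x -> inner U (x^-1)%g.
Proof.
have Us : forall a, U a -> U (a^-1)%g by case: locU => -[].
move=> [Ux mx]; have Ux' : star_set U (x^-1)%g by exact: star_setV Ux.
split=> // y xy; rewrite -[y]invgK; apply: star_setV Us _; apply: mx.
by have := approx_inv Ux' xy; rewrite invgK.
Qed.

Lemma inner1 : inner U 1%g.
Proof.
case: locU => -[oU U1 _] _; split; first exact/star_std.
by move=> y; rewrite /monad_at /= /approx_l invg1 mul1g; apply.
Qed.

End LocallyUniformMonads.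

Definition sufficiently_saturated : Prop := saturated N (G -> G -> R).

Lemma saturated_inner (sat : sufficiently_saturated) (U : set G) x :
  monad_at x `<=` star_set U ->
  exists2 O, nbhs (1%g : G) O &
    forall y, star_set O (x^-1 * y)%g -> star_set U y.
Proof.
move=> mU; apply: contrapT => nex.
have bad O : nbhs (1%g : G) O ->
    exists2 y, star_set O (x^-1 * y)%g & ~ star_set U y.
  move=> nO; apply: contrapT => nbad; apply: nex; exists O => // y Oy.
  by apply: contrapT => nUy; apply: nbad; exists y.
pose code (k : G -> G -> R) := [set t : G | k t t = 1].
pose O k := if pselect (nbhs (1%g : G) (code k)) then code k else setT.
have nO k : nbhs (1%g : G) (O k).
  by rewrite /O; case: pselect => //= _; exact: filterT.
pose F k (v : G) := [set w | O k (v^-1 * w)%g /\ ~ U w].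
have memF y k : star_mem y (smap (F k) x) <->
    star_set (O k) (x^-1 * y)%g /\ ~ star_set U y.
  have [t [-> ->]] := star_common2 x y.
  rewrite /star_mem -smap_comp spairE smapV smapM !star_preimage.
  split=> [/star_setI[h1 /star_setC h2]//|[h1 /star_setC h2]].
  exact/star_setI.
have [] := sat _ (fun k => smap (F k) x).
  move=> n k; have /bad[y Oy nUy] : nbhs (1%g : G) [set t | forall i, O (k i) t].
    by apply: filter_forall => i; exact: nO.
  exists y => i; apply/memF; split=> //.
  by apply: star_subset Oy => t; apply.
move=> y yF; have [_ nUy] := (memF _ _).1 (yF (fun _ _ => 0)).
apply: nUy; apply: mU; apply/monadP => V nV.
have := (memF _ _).1 (yF (fun t _ => if pselect (V t) then 1 else 0)) => -[+ _].
set k := fun _ => _; have cV : code k = V.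
  apply/seteqP; split=> t; rewrite /code /k /=; case: pselect => //.
  by move=> _ /eqP; rewrite eq_sym oner_eq0.
by rewrite /O cV; case: pselect.
Qed.

End Monads.

(* The parameters (U, S) of a nonstandard hull of G. *)
Record hull_datum (R : realType) (G : topologicalGroupType) := HullDatum {
  hull_U : set G;
  hull_S : set (G -> G -> R);
  hull_locU : locally_uniform_at hull_U;
  hull_S_sub : hull_S `<=` left_pseudometrics R G;
  hull_S_gen : generated_uniformity hull_S = left_uniformity G;
  hull_S_max : closed_under_max hull_S }.

(* The set of classes [x] with x in U_{S,f}. *)
Definition hull_type (N : nonstandard_universe) (R : realType)
    (G : topologicalGroupType) (h : hull_datum R G) : Type :=
  {A : set (star N G) |
     exists2 x, finite_part (hull_U h) (hull_S h) x & A = monad_at x}.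

Section HullSpace.
Variables (N : nonstandard_universe) (R : realType).
Variables (G : topologicalGroupType) (h : hull_datum R G).
Local Notation U := (hull_U h).
Local Notation S := (hull_S h).
Local Notation Uf := (@finite_part N R G U S).
Local Notation H := (hull_type N h).
Implicit Types (x y : star N G) (p : G -> G -> R).

Lemma S_pseudo p : S p -> pseudometric p.
Proof. by case/hull_S_sub. Qed.

Lemma S_invariant p : S p -> left_invariant p.
Proof. by case/hull_S_sub. Qed.

Lemma S_nbhs1 p e : S p -> 0 < e -> nbhs (1%g : G) [set t | p 1%g t < e].
Proof.
move=> Sp e0; have [p0 _ _] := S_pseudo Sp.
have [_ _ pc] := hull_S_sub Sp.
have /cvgrPdist_lt /(_ e e0) := pc (1%g, 1%g).
move=> [[B C] /= [nB nC] BC]; apply: filterS nC => t Ct /=.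
apply: le_lt_trans (ler_norm _) _; rewrite -normrN -sub0r -(p0 1%g).
by apply: (BC (1%g, t)); split=> //; exact: nbhs_singleton.
Qed.

Lemma finite_part_dist p x y : S p -> Uf x -> Uf y ->
  finite_hyperreal (smap2 p x y).
Proof.
move=> Sp [_ /(_ p Sp)] + [_ /(_ p Sp)].
have pge0 a b : 0 <= p a b by exact/pseudometric_ge0/S_pseudo.
have [_ ps pt] := S_pseudo Sp; rewrite star_oneE.
have [t [-> ->]] := star_common2 x y; rewrite -(smap_const 1%g t) !smap2E.
move=> fx fy; apply: finite_dom fx fy _ => -[a b] /=.
by rewrite !ger0_norm// (ps b).
Qed.

Lemma approx_dist p x y e : S p -> 0 < e -> approx_l x y ->
  star_set [set t | t < e] (smap2 p x y).
Proof.
move=> Sp e0 /monadP /(_ _ (S_nbhs1 Sp e0)).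
have pinv := S_invariant Sp; have [t [-> ->]] := star_common2 x y.
rewrite smapV smapM smap2E => /star_preimage ht; apply/star_preimage.
apply: star_subset ht => -[a b] /=.
by rewrite -(pinv a) mulg1 mulVKg.
Qed.

Lemma finite_part_approx x y : approx_l x y -> Uf x -> Uf y.
Proof.
move=> xy [Ix fx]; split; first exact: inner_approx xy Ix.
move=> p Sp; have := fx p Sp; have := approx_dist Sp ltr01 xy.
have pge0 a b : 0 <= p a b by exact/pseudometric_ge0/S_pseudo.
have [_ ps pt] := S_pseudo Sp; rewrite star_oneE.
have [t [-> ->]] := star_common2 x y; rewrite -(smap_const 1%g t) !smap2E.
move=> /star_preimage pxy [c /star_preimage px1]; exists (1 + c).
apply/star_preimage; have /star_setI := conj pxy px1.
apply: star_subset => -[a b] /= [h1 h2].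
have := pt a b 1%g; rewrite (ps b a); by move: h2; rewrite !ger0_norm// => h2 h3; lra.
Qed.

Lemma finite_part1 : Uf 1%g.
Proof.
split; first exact: (inner1 _ (hull_locU h)).
move=> p Sp; have [p0 _ _] := S_pseudo Sp.
exists 0; rewrite star_oneE -(smap_const 1%g (std tt)) smap2E.
by rewrite (smap_const (p 1%g 1%g)); apply/star_std; rewrite /= p0 normr0.
Qed.

Lemma finite_partV x : Uf x -> Uf (x^-1)%g.
Proof.
move=> [Ix fx]; split; first exact: (inner_inv (hull_locU h)).
move=> p Sp; move: (fx p Sp); have [_ ps _] := S_pseudo Sp.
have pinv := S_invariant Sp.
rewrite star_oneE star_invE -(smap_const 1%g x) -{1}(smap_id x) !smap2E.
congr finite_hyperreal; congr smap; apply/funext => a /=.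
by rewrite -(pinv a (a^-1)%g) mulgV mulg1 ps.
Qed.

Lemma finite_partM x y : Uf x -> Uf y -> inner U (x * y)%g -> Uf (x * y)%g.
Proof.
move=> [_ fx] [_ fy] Ixy; split=> // p Sp; move: (fx p Sp) (fy p Sp).
have pge0 a b : 0 <= p a b by exact/pseudometric_ge0/S_pseudo.
have [_ ps pt] := S_pseudo Sp; have pinv := S_invariant Sp.
rewrite star_oneE; have [t [-> ->]] := star_common2 x y.
rewrite smapM -(smap_const 1%g t) !smap2E => f1 f2.
apply: finite_dom f1 f2 _ => -[a b] /=; rewrite !ger0_norm//.
have e : p (a * b)%g a = p b 1%g by rewrite -{2}(mulg1 a) pinv.
by have := pt a (a * b)%g 1%g; rewrite e addrC.
Qed.

Definition hull_rep (a : H) : star N G := s2val (cid2 (svalP a)).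

Lemma hull_rep_in a : Uf (hull_rep a).
Proof. by rewrite /hull_rep; case: cid2. Qed.

Lemma hull_rep_val a : sval a = monad_at (hull_rep a).
Proof. by rewrite /hull_rep; case: cid2. Qed.

(* The class [x], for x in U_{S,f}. *)
Definition hull_class x (Ux : Uf x) : H :=
  exist _ (monad_at x) (ex_intro2 _ _ x Ux erefl).

Lemma hull_val_inj (a b : H) : sval a = sval b -> a = b.
Proof.
by case: a b => [A hA] [B hB] /= e; subst B; congr exist; exact: Prop_irrelevance.
Qed.

Lemma hull_eqP (a b : H) : a = b <-> approx_l (hull_rep a) (hull_rep b).
Proof.
split=> [->|ab]; first exact: approx_refl.
by apply: hull_val_inj; rewrite !hull_rep_val; exact: monad_at_eq.
Qed.

Lemma hull_rep_class x (Ux : Uf x) : approx_l x (hull_rep (hull_class Ux)).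
Proof. by apply: monad_at_approx; rewrite -hull_rep_val. Qed.

Lemma hull_class_eq x y (Ux : Uf x) (Uy : Uf y) :
  approx_l x y -> hull_class Ux = hull_class Uy.
Proof. by move=> xy; apply: hull_val_inj; exact: monad_at_eq. Qed.

(* The pseudometric °p on the hull. *)
Definition hull_dist (p : G -> G -> R) (a b : H) : R :=
  st (smap2 p (hull_rep a) (hull_rep b)).

Lemma st_dist_approx p x x' y y' : S p -> Uf x -> Uf y ->
  approx_l x x' -> approx_l y y' -> st (smap2 p x y) <= st (smap2 p x' y').
Proof.
move=> Sp Ux Uy xx' yy'.
have Ux' := finite_part_approx xx' Ux; have Uy' := finite_part_approx yy' Uy.
rewrite leNgt; apply/negP => hlt.
have := stP (finite_part_dist Sp Ux' Uy'); have := stP (finite_part_dist Sp Ux Uy).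
move: hlt; set r := st _; set r' := st _ => hlt.
have [e e0 er] : exists2 e, 0 < e & r' - r = 4 * e.
  by exists ((r' - r) / 4); lra.
move=> /(_ e e0) + /(_ e e0); clearbody r r'.
have := approx_dist Sp e0 xx'; have := approx_dist Sp e0 (approx_sym yy').
have [t [-> -> -> ->]] := star_common4 x x' y y'; rewrite !smap2E.
move=> /star_preimage h1 /star_preimage h2 /star_preimage h3 /star_preimage h4.
have /star_setI h12 := conj h1 h2; have /star_setI h34 := conj h3 h4.
have /star_setI := conj h12 h34; set B := _ `&` _.
suff -> : B = ~` setT by move/star_setC; apply; exact: star_setT.
have [_ ps pt] := S_pseudo Sp.
rewrite setCT -subset0 => -[[[a a'] b] b'] [[/= k1 k2] [k3 k4]].
have l1 := pt a' a b; have l2 := pt b' a' b.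
by move: k3 k4; rewrite !ltr_norml => /andP[k3 k3'] /andP[k4 k4']; lra.
Qed.

Lemma hull_dist_class p x y (Ux : Uf x) (Uy : Uf y) : S p ->
  hull_dist p (hull_class Ux) (hull_class Uy) = st (smap2 p x y).
Proof.
move=> Sp; have cx := hull_rep_class Ux; have cy := hull_rep_class Uy.
by apply/eqP; rewrite eq_le !st_dist_approx//;
  do ?[exact: hull_rep_in|exact: approx_sym].
Qed.

Lemma hull_dist_pseudometric p : S p -> pseudometric (hull_dist p).
Proof.
move=> Sp; have [p0 ps pt] := S_pseudo Sp; split.
- move=> a; rewrite /hull_dist -[hull_rep a](smap_id) smap2E.
  have -> : (fun t => p (id t) (id t)) = fun=> 0 by apply/funext => t; rewrite p0.
  by rewrite smap_const st_std.
- move=> a b; rewrite /hull_dist.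
  have [t [-> ->]] := star_common2 (hull_rep a) (hull_rep b).
  by rewrite !smap2E; congr (st (smap _ t)); apply/funext => u; rewrite ps.
- move=> b a c; rewrite /hull_dist.
  have := finite_part_dist Sp (hull_rep_in a) (hull_rep_in b).
  have := finite_part_dist Sp (hull_rep_in b) (hull_rep_in c).
  have := finite_part_dist Sp (hull_rep_in a) (hull_rep_in c).
  have [t [-> -> ->]] := star_common3 (hull_rep a) (hull_rep b) (hull_rep c).
  rewrite !smap2E => fac fbc fab; rewrite -stD//; apply: st_le => //.
  apply: finite_dom fab fbc _ => u; exact: ler_normD.
Qed.

Definition hull_entourage : set_system (H * H) :=
  generated_uniformity [set q | exists2 p, S p & q = hull_dist p].

Let pseudo q : [set q | exists2 p, S p & q = hull_dist p] q -> pseudometric q.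
Proof. by move=> [p Sp ->]; exact: hull_dist_pseudometric. Qed.

HB.instance Definition _ := gen_eqMixin H.
HB.instance Definition _ := gen_choiceMixin H.
HB.instance Definition _ := @isUniform.Build H hull_entourage
  (generated_uniformity_filter _) (generated_uniformity_refl pseudo)
  (generated_uniformity_inv pseudo) (generated_uniformity_split pseudo).

Lemma hull_nbhsP (a : H) (A : set H) : nbhs a A <->
  exists2 O, nbhs (1%g : G) O &
    [set b | star_set O ((hull_rep a)^-1 * hull_rep b)%g] `<=` A.
Proof.
split=> [|[O]].
  rewrite -nbhs_entourageE => -[E EE EA].
  suff [O nO OE] : exists2 O, nbhs (1%g : G) O &
      forall b, star_set O ((hull_rep a)^-1 * hull_rep b)%g -> E (a, b).
    by exists O => // b /OE ?; apply: EA; exact/mem_set.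
  move: E EE {EA}; apply: generated_uniformity_ind.
    split; first by exists setT => //; exact: filterT.
    - move=> A1 A2 [O1 n1 h1] [O2 n2 h2]; exists (O1 `&` O2).
        exact: filterI.
      by move=> b /star_setI[o1 o2]; split; [exact: h1|exact: h2].
    - by move=> A1 A2 A12 [O nO hO]; exists O => // b /hO/A12.
  move=> _ e [p Sp ->] e0; have e2 : 0 < e / 2 by rewrite divr_gt0.
  exists [set t | p 1%g t < e / 2]; first exact: S_nbhs1.
  move=> b hb /=; apply: (@le_lt_trans _ _ (e / 2)); last by lra.
  apply: st_leP; first by apply: finite_part_dist => //; exact: hull_rep_in.
  move: hb; have pinv := S_invariant Sp.
  have [t [-> ->]] := star_common2 (hull_rep a) (hull_rep b).
  rewrite smapV smapM smap2E => /star_preimage ht; apply/star_preimage.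
  apply: star_subset ht => -[u v] /=.
  by rewrite -(pinv u) mulg1 mulVKg => /ltW.
rewrite nbhsE => -[O' oO' O'O] OA.
have := hull_S_gen h; set L := left_uniformity G => gL.
have : L [set xy | O' (xy.1^-1 * xy.2)%g] by exists O'.
rewrite -gL => /(generated_uniformity_max (@hull_S_max _ _ h)).
move=> [e|[p [e [Sp e0 pO]]]].
  suff -> : A = setT by exact: filterT.
  rewrite -subTset => b _; apply: OA => /=.
  suff -> : O = setT by exact: star_setT.
  rewrite -subTset => t _; apply: O'O.
  have : [set: G * G] (1%g, t) by [].
  by rewrite -e /= invg1 mul1g.
rewrite -nbhs_entourageE.
exists [set xy | hull_dist p xy.1 xy.2 < e].
  by apply: generated_uniformity_ball => //; exists p.
move=> b /set_mem /= hb; apply: OA => /=.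
have := st_lt (finite_part_dist Sp (hull_rep_in a) (hull_rep_in b)) hb.
have [t [-> ->]] := star_common2 (hull_rep a) (hull_rep b).
rewrite smapV smapM smap2E => /star_preimage ht; apply/star_preimage.
by apply: star_subset ht => -[u v] /= huv; apply: O'O; exact: (pO (u, v)).
Qed.

Definition hull_one : H := hull_class finite_part1.

Definition hull_dom : set (H * H) := [set ab | exists x y,
  [/\ Uf x, Uf y, Uf (x * y)%g, sval ab.1 = monad_at x &
      sval ab.2 = monad_at y]].

(* [x][y] = [xy]; the value outside of the product domain is irrelevant. *)
Definition hull_mul (a b : H) : H :=
  if pselect (Uf (hull_rep a * hull_rep b)%g) is left Uab
  then hull_class Uab else hull_one.

Definition hull_inv (a : H) : H := hull_class (finite_partV (hull_rep_in a)).

Lemma hull_domP (a b : H) :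
  hull_dom (a, b) <-> inner U (hull_rep a * hull_rep b)%g.
Proof.
split=> [[x [y /= [Ux Uy [Ixy _] ax bY]]]|Iab]; last first.
  exists (hull_rep a), (hull_rep b); rewrite -!hull_rep_val; split=> //;
    do ?exact: hull_rep_in.
  by apply: finite_partM => //; exact: hull_rep_in.
apply: inner_approx Ixy; apply: (approx_mul (hull_locU h)).
- by case: Uy => -[].
- by apply: monad_at_approx; rewrite -hull_rep_val.
- by apply: monad_at_approx; rewrite -hull_rep_val.
Qed.

Lemma hull_mulP (a b : H) : hull_dom (a, b) ->
  approx_l (hull_rep (hull_mul a b)) (hull_rep a * hull_rep b)%g.
Proof.
move=> /hull_domP Iab; rewrite /hull_mul; case: pselect => [Uab|[]].
  exact/approx_sym/hull_rep_class.
by apply: finite_partM => //; exact: hull_rep_in.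
Qed.

Lemma hull_mul_class x y (Ux : Uf x) (Uy : Uf y) (Uxy : Uf (x * y)%g) :
  hull_dom (hull_class Ux, hull_class Uy) /\
  hull_mul (hull_class Ux) (hull_class Uy) = hull_class Uxy.
Proof.
have d : hull_dom (hull_class Ux, hull_class Uy) by exists x, y.
split=> //; apply/hull_eqP; apply: approx_trans (hull_mulP d) _.
apply: approx_trans (hull_rep_class Uxy); apply: approx_sym.
apply: (approx_mul (hull_locU h)); do ?exact: hull_rep_class.
by have [[]] := Uy.
Qed.

Lemma hull_invP (a : H) :
  approx_l (hull_rep (hull_inv a)) ((hull_rep a)^-1)%g.
Proof. exact/approx_sym/hull_rep_class. Qed.

Lemma hull_inv_class x (Ux : Uf x) (Ux' : Uf (x^-1)%g) :
  hull_inv (hull_class Ux) = hull_class Ux'.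
Proof.
apply/hull_eqP; apply: approx_trans (hull_invP _) _.
apply: approx_trans (hull_rep_class Ux'); apply: approx_sym.
by apply: (approx_inv (hull_locU h)); [have [[]] := Ux|exact: hull_rep_class].
Qed.

End HullSpace.

Arguments hull_dom {N R G h}.

Lemma mulg_chain (K : groupType) (r v w s : K) :
  (r^-1 * s = (r^-1 * v) * (v^-1 * w) * (w^-1 * s))%g.
Proof. by rewrite -!mulgA !mulVKg. Qed.

Section HullLocalGroup.
Variables (N : nonstandard_universe) (R : realType).
Variables (G : topologicalGroupType) (sat : sufficiently_saturated N R G).
Variable h : hull_datum R G.
Local Notation U := (hull_U h).
Local Notation S := (hull_S h).
Local Notation Uf := (@finite_part N R G U S).
Local Notation H := (hull_type N h).

Let rep_in_U (a : H) : star_set U (hull_rep a).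
Proof. by have [[]] := hull_rep_in a. Qed.

Lemma hull_hausdorff : hausdorff_space H.
Proof.
move=> a b ab; apply/hull_eqP; apply/monadP => O /nbhs1_mul[O' nO' h'].
have nV := nbhs1_inv nO'.
have nA : nbhs a [set c : H | star_set O' ((hull_rep a)^-1 * hull_rep c)%g].
  by apply/hull_nbhsP; exists O'.
have nB : nbhs b [set c : H | star_set [set t | O' (t^-1)%g]
    ((hull_rep b)^-1 * hull_rep c)%g].
  by apply/hull_nbhsP; exists [set t | O' (t^-1)%g].
have [c [/= ac bc]] := ab _ _ nA nB.
have E : ((hull_rep a)^-1 * hull_rep b =
   ((hull_rep a)^-1 * hull_rep c) * ((hull_rep b)^-1 * hull_rep c)^-1)%g.
  by rewrite invgM invgK -mulgA mulVKg.
by rewrite E; apply: (star_setM h') => //; apply: star_setV bc.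
Qed.

Lemma hull_dom_open : open (hull_dom : set (H * H)).
Proof.
rewrite openE => -[a b] /hull_domP[Uab mab]; rewrite /interior.
have [O nO hO] := saturated_inner sat mab.
have [O1 nO1 hO1] := nbhs1_mul nO.
have [O2 nO2 hO2] := star_mul_near N (hull_locU h) nO1.
exists ([set a' | star_set O2 ((hull_rep a)^-1 * hull_rep a')%g],
        [set b' | star_set O2 ((hull_rep b)^-1 * hull_rep b')%g]).
  by split; apply/hull_nbhsP; exists O2.
move=> [a' b'] [/= aa' bb']; apply/hull_domP.
have near1 := hO2 _ _ _ _ (rep_in_U b) aa' bb'.
split=> [|y /monadP hy]; apply: hO.
  rewrite -[X in star_set O X]mulg1; apply: star_setM hO1 near1 _.
  by move/monadP: (@monad1 N G); apply.
set v := (hull_rep a' * hull_rep b')%g in near1 hy *.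
rewrite -[y](mulVKg v) mulgA; exact: star_setM hO1 near1 (hy _ nO1).
Qed.

Lemma hull_mul_continuous :
  {within (hull_dom : set (H * H)),
    continuous (fun xy => hull_mul xy.1 xy.2)}.
Proof.
apply/subspace_continuousP => -[a b] dab A /= /hull_nbhsP[O nO OA].
have [O1 nO1 hO1] := nbhs1_mul nO; have [O2 nO2 hO2] := nbhs1_mul nO1.
have [O3 nO3 hO3] := star_mul_near N (hull_locU h) nO2.
exists ([set a' | star_set O3 ((hull_rep a)^-1 * hull_rep a')%g],
        [set b' | star_set O3 ((hull_rep b)^-1 * hull_rep b')%g]).
  by split; apply/hull_nbhsP; exists O3.
move=> [a' b'] [/= aa' bb'] dab'; apply: OA => /=.
have near := hO3 _ _ _ _ (rep_in_U b) aa' bb'.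
have /monadP/(_ _ nO2) h1 := hull_mulP dab.
have /monadP/(_ _ nO1) h2 := approx_sym (hull_mulP dab').
set v := (hull_rep a * hull_rep b)%g in near h1.
set w := (hull_rep a' * hull_rep b')%g in near h2.
move: h1 h2; set r := hull_rep _; set r' := hull_rep _ => h1 h2.
rewrite (mulg_chain _ v w).
exact: star_setM hO1 (star_setM hO2 h1 near) h2.
Qed.

Lemma hull_inv_continuous :
  {within ([set: H]), continuous (@hull_inv N R G h)}.
Proof.
apply/subspace_continuousP => a _ A /= /hull_nbhsP[O nO OA].
have [O1 nO1 hO1] := nbhs1_mul nO; have [O2 nO2 hO2] := nbhs1_mul nO1.
have [O3 nO3 hO3] := star_inv_near N (hull_locU h) nO2.
suff : nbhs a [set a' | A (hull_inv a')] by apply: filterS.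
apply/hull_nbhsP; exists O3 => // a' aa'; apply: OA => /=.
have near := hO3 _ _ (rep_in_U a) aa'.
have /monadP/(_ _ nO2) h1 := hull_invP a.
have /monadP/(_ _ nO1) h2 := approx_sym (hull_invP a').
set v := ((hull_rep a)^-1)%g in near h1.
set w := ((hull_rep a')^-1)%g in near h2.
move: h1 h2; set r := hull_rep _; set r' := hull_rep _ => h1 h2.
rewrite (mulg_chain _ v w).
exact: star_setM hO1 (star_setM hO2 h1 near) h2.
Qed.

Let rep1 : approx_l (hull_rep (hull_one N h)) 1%g.
Proof. exact/approx_sym/hull_rep_class. Qed.

Let mul_near (a b : H) x y : hull_dom (a, b) ->
  approx_l (hull_rep a) x -> approx_l (hull_rep b) y ->
  approx_l (hull_rep (hull_mul a b)) (x * y)%g.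
Proof.
move=> d ax bY; apply: approx_trans (hull_mulP d) _.
exact: (approx_mul (hull_locU h)).
Qed.

Let dom_near (a b c : H) x y : approx_l (hull_rep a) x ->
  approx_l (hull_rep b) y -> inner U (x * y)%g -> hull_dom (a, b).
Proof.
move=> ax bY Ixy; apply/hull_domP; apply: inner_approx Ixy.
apply: approx_sym; exact: (approx_mul (hull_locU h)).
Qed.

Lemma hull_dom1x (a : H) : hull_dom (hull_one N h, a).
Proof.
apply: (dom_near a rep1 (approx_refl _)); rewrite mul1g.
by case: (hull_rep_in a).
Qed.

Lemma hull_domx1 (a : H) : hull_dom (a, hull_one N h).
Proof.
apply: (dom_near a (approx_refl _) rep1); rewrite mulg1.
by case: (hull_rep_in a).
Qed.

Lemma hull_mul1x (a : H) : hull_mul (hull_one N h) a = a.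
Proof.
apply/hull_eqP; have := mul_near (hull_dom1x a) rep1 (approx_refl _).
by rewrite mul1g.
Qed.

Lemma hull_mulx1 (a : H) : hull_mul a (hull_one N h) = a.
Proof.
apply/hull_eqP; have := mul_near (hull_domx1 a) (approx_refl _) rep1.
by rewrite mulg1.
Qed.

Lemma hull_domxV (a : H) : hull_dom (a, hull_inv a).
Proof.
apply: (dom_near a (approx_refl _) (hull_invP a)); rewrite mulgV.
exact: (inner1 N (hull_locU h)).
Qed.

Lemma hull_domVx (a : H) : hull_dom (hull_inv a, a).
Proof.
apply: (dom_near a (hull_invP a) (approx_refl _)); rewrite mulVg.
exact: (inner1 N (hull_locU h)).
Qed.

Lemma hull_mulxV (a : H) : hull_mul a (hull_inv a) = hull_one N h.
Proof.
apply/hull_eqP; apply: approx_trans (approx_sym rep1).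
by have := mul_near (hull_domxV a) (approx_refl _) (hull_invP a); rewrite mulgV.
Qed.

Lemma hull_mulVx (a : H) : hull_mul (hull_inv a) a = hull_one N h.
Proof.
apply/hull_eqP; apply: approx_trans (approx_sym rep1).
by have := mul_near (hull_domVx a) (hull_invP a) (approx_refl _); rewrite mulVg.
Qed.

Lemma hull_mulA (a b c : H) : hull_dom (a, b) -> hull_dom (b, c) ->
  hull_dom (hull_mul a b, c) -> hull_dom (a, hull_mul b c) ->
  hull_mul (hull_mul a b) c = hull_mul a (hull_mul b c).
Proof.
move=> dab dbc dabc dabc'; apply/hull_eqP.
apply: approx_trans (mul_near dabc (hull_mulP dab) (approx_refl _)) _.
rewrite -mulgA; apply: approx_sym.
exact: mul_near dabc' (approx_refl _) (hull_mulP dbc).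
Qed.

Definition nonstandard_hull : local_group := {|
  lg_sort := H;
  lg_one := hull_one N h;
  lg_dom := hull_dom;
  lg_mul := @hull_mul N R G h;
  lg_invdom := setT;
  lg_inv := @hull_inv N R G h;
  lg_hausdorff := hull_hausdorff;
  lg_dom_open := hull_dom_open;
  lg_mul_continuous := hull_mul_continuous;
  lg_invdom_open := openT;
  lg_inv_continuous := hull_inv_continuous;
  lg_invdom1 := I;
  lg_dom1x := hull_dom1x;
  lg_domx1 := hull_domx1;
  lg_mul1x := hull_mul1x;
  lg_mulx1 := hull_mulx1;
  lg_domxV := fun a _ => hull_domxV a;
  lg_domVx := fun a _ => hull_domVx a;
  lg_mulxV := fun a _ => hull_mulxV a;
  lg_mulVx := fun a _ => hull_mulVx a;
  lg_mulA := hull_mulA |}.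

End HullLocalGroup.

(* A compatible left-invariant metric d and a ball around the identity for
   which G is locally uniform. *)
Record metric_hull_datum (R : realType) (G : topologicalGroupType) :=
    MetricHullDatum {
  mh_dist : G -> G -> R;
  mh_radius : R;
  mh_compatible : compatible_metric mh_dist;
  mh_invariant : left_invariant mh_dist;
  mh_locU : locally_uniform_at [set x | mh_dist x 1%g < mh_radius] }.

Section MetricHull.
Variables (R : realType) (G : topologicalGroupType).
Variable m : metric_hull_datum R G.
Local Notation d := (mh_dist m).

Let dball x e : 0 < e -> nbhs x [set y | d x y < e].
Proof. by move=> e0; have [_ _ ->] := mh_compatible m; exists e. Qed.

Lemma mh_S_sub : [set d] `<=` left_pseudometrics R G.
Proof.
move=> _ ->; have [dp _ _] := mh_compatible m; have [d0 ds dt] := dp.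
split=> //; first exact: mh_invariant.
move=> [x y]; apply/cvgrPdist_lt => e e0.
have e2 : 0 < e / 2 by rewrite divr_gt0.
exists ([set x' | d x x' < e / 2], [set y' | d y y' < e / 2]).
  by split; exact: dball.
move=> [x' y'] [/= xx' yy']; rewrite ltr_norml.
have h1 := dt x' x y; have h2 := dt y' x' y.
have h3 := dt x x' y'; have h4 := dt y x y'.
by move: h2 h3; rewrite (ds y' y) (ds x' x) => h2 h3; lra.
Qed.

Lemma mh_S_max : closed_under_max [set d].
Proof.
move=> p q -> ->; apply/funext => x; apply/funext => y; exact: maxxx.
Qed.

Lemma mh_S_gen : generated_uniformity [set d] = left_uniformity G.
Proof.
have [dp _ _] := mh_compatible m; have [d0 _ _] := dp.
have dinv := mh_invariant m.
apply/seteqP; split=> [A /(generated_uniformity_max mh_S_max)|A [O [oO O1] OA]].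
  move=> [->|[p [e [-> e0 dA]]]].
    by exists setT => //; split=> //; exact: openT.
  have := dball 1%g e0; rewrite nbhsE => -[O oO Oe].
  exists O => // -[x y] /Oe /= h; apply: dA => /=.
  by rewrite -(dinv (x^-1)%g) mulVg.
have : nbhs (1%g : G) O by exact: open_nbhs_nbhs.
have [_ _ ->] := mh_compatible m; move=> [e e0 eO].
apply: (@filterS _ _ (generated_uniformity_filter _)) OA _.
apply: (@filterS _ _ (generated_uniformity_filter _)); last first.
  exact: (@generated_uniformity_ball _ _ _ d e).
move=> [x y] /= h; apply: eO => /=.
by rewrite -(dinv x) mulg1 mulVKg.
Qed.

Definition metric_hull_parameters : hull_datum R G :=
  HullDatum (mh_locU m) mh_S_sub mh_S_gen mh_S_max.

End MetricHull.

Definition metric_nonstandard_hull (N : nonstandard_universe) (R : realType)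
    (G : topologicalGroupType) (sat : sufficiently_saturated N R G)
    (m : metric_hull_datum R G) : local_group :=
  nonstandard_hull sat (metric_hull_parameters m).

(* "The metric nonstandard hull of G is P": G has metric nonstandard hulls and
   all of them, being locally isomorphic, satisfy P. *)
Definition the_metric_hull_is (N : nonstandard_universe) (R : realType)
    (G : topologicalGroupType) (sat : sufficiently_saturated N R G)
    (P : local_group -> Prop) : Prop :=
  inhabited (metric_hull_datum R G) /\
  forall m : metric_hull_datum R G, P (metric_nonstandard_hull sat m).

(* Main.v *)
Require Import Defs.
From HB Require Import structures.
From mathcomp Require Import all_boot all_order all_algebra.
From mathcomp Require Import all_classical all_reals topology normedtype.
From mathcomp Require Import lra.

Set Implicit Arguments.
Unset Strict Implicit.
Unset Printing Implicit Defensive.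
Import Order.TTheory GRing.Theory Num.Theory.
Local Open Scope classical_set_scope.
Local Open Scope ring_scope.

(** Everything rests on two passages between G and its hulls.

    Downwards ([metric_hull_NSS_uniformly_NSS]): if G is not uniformly NSS,
    then for every symmetric neighbourhood W of 1 there are a neighbourhood V
    of 1 and, for each n, a point outside V whose first n powers lie in W.
    Countable saturation turns these points into a single nonstandard x outside
    V^* all of whose standard powers lie in W^*.  If W is small, these powers
    are finite and well inside U^*, so their classes form a subgroup of the
    metric hull; it is as small as desired, and nontrivial since x is not
    infinitely close to 1.  Hence the metric hull is not NSS.

    Upwards ([uniformly_NSS_hull]): powers in a hull are computed by powers of
    representatives, up to an infinitesimal error, and for each V uniform NSS
    bounds the exponents to be looked at by a standard number n_V.  The
    escaping power of a representative is therefore found among finitely many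
    standard exponents, and uniform NSS passes to every hull whatsoever.

    For local groups, uniform NSS implies NSS because the powers of an element
    of a subgroup are all defined and remain in the subgroup.  So any of the
    four conditions yields uniform NSS of G, which yields the others, as soon
    as G has a metric hull at all.  That is the theorem of Birkhoff and
    Kakutani: a first countable Hausdorff group has a compatible left-invariant
    metric ([left_invariant_metric_exists]), whose small balls inherit local
    uniformity.  It applies because uniform NSS
    produces a countable base at 1: the sets of points whose first n powers
    stay in U ([uniformly_NSS_countable_nbhs1_base]). *)

(** * Left-invariant metrics *)

(** A copy of G whose topology is by construction the one of the left
    uniformity, so that the metrization theorem for uniform spaces applies. *)
Definition left_uniform_space (G : topologicalGroupType) : Type := G.

Section LeftUniformSpace.
Variable G : topologicalGroupType.

Let left_entourage O : nbhs (1%g : G) O ->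
  left_uniformity G [set xy | O (xy.1^-1 * xy.2)%g].
Proof.
by rewrite nbhsE => -[O' oO' O'O]; exists O' => // xy /=; exact: O'O.
Qed.

Let left_uniformityP A : left_uniformity G A ->
  exists2 O, nbhs (1%g : G) O & [set xy | O (xy.1^-1 * xy.2)%g] `<=` A.
Proof. by move=> [O /open_nbhs_nbhs nO OA]; exists O. Qed.

Let left_filter : Filter (left_uniformity G).
Proof.
apply: filter_from_filter; first by exists setT; split=> //; exact: openT.
move=> A B oA oB; exists (A `&` B); last by move=> xy [].
exact: open_nbhsI.
Qed.

Let left_refl A : left_uniformity G A -> diagonal `<=` A.
Proof.
move=> /left_uniformityP[O nO OA] [x y]; rewrite /diagonal /= => ->.
by apply: OA; rewrite /= mulVg; exact: nbhs_singleton.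
Qed.

Let left_sym A : left_uniformity G A -> left_uniformity G (A^-1)%relation.
Proof.
move=> /left_uniformityP[O /nbhs1_inv/left_entourage nO OA].
apply: (@filterS _ _ left_filter) nO => -[x y] /=.
by rewrite invgM invgK => h; exact: OA.
Qed.

Let left_split A : left_uniformity G A ->
  exists2 B, left_uniformity G B & (B \; B)%relation `<=` A.
Proof.
move=> /left_uniformityP[O /nbhs1_mul[O' /left_entourage nO' h] OA].
exists [set xy | O' (xy.1^-1 * xy.2)%g] => // -[x z] /= [y /= xy yz].
by apply: OA => /=; have := h _ _ xy yz; rewrite -mulgA mulVKg.
Qed.

HB.instance Definition _ := Choice.on (left_uniform_space G).
HB.instance Definition _ := @isUniform.Build (left_uniform_space G)
  (left_uniformity G) left_filter left_refl left_sym left_split.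

Lemma left_uniform_entourageP (A : set (G * G)) :
  @entourage (left_uniform_space G) A <->
  exists2 O, nbhs (1%g : G) O & [set xy | O (xy.1^-1 * xy.2)%g] `<=` A.
Proof.
split=> [/left_uniformityP//|[O /left_entourage nO OA]].
exact: (@filterS _ _ left_filter) nO.
Qed.

End LeftUniformSpace.

Section BirkhoffKakutani.
Variables (R : realType) (G : topologicalGroupType).

Definition countable_nbhs1_base : Prop :=
  exists2 f : nat -> set G, forall n, nbhs (1%g : G) (f n) &
    forall O, nbhs (1%g : G) O -> exists n, f n `<=` O.

(** The metric given by metrizability need not be left invariant; only the
    countable base that it provides is kept. *)
Lemma metrizable_countable_nbhs1_base :
  metrizable R G -> countable_nbhs1_base.
Proof.
move=> [d [_ _ dnbhs]].
exists (fun n => [set y | d 1%g y < n.+1%:R^-1]).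
  by move=> n; rewrite dnbhs; exists n.+1%:R^-1 => //=; rewrite invr_gt0.
move=> O; rewrite dnbhs => -[e /= e0 eO]; exists (Num.truncn e^-1).
move=> y /= dy; apply: eO; apply: lt_le_trans dy _.
by rewrite -[leRHS]invrK lef_pV2 ?posrE ?invr_gt0// ltW// truncnS_gt.
Qed.

Lemma left_uniformity_countable : countable_nbhs1_base ->
  countable_uniformity (left_uniform_space G).
Proof.
move=> [f nf fO]; apply/countable_uniformityP.
exists (fun n => [set xy : G * G | f n (xy.1^-1 * xy.2)%g]).
  move=> A /left_uniform_entourageP[O /fO[n fnO] OA]; exists n => xy /= h.
  exact/OA/fnO.
by move=> n; apply/left_uniform_entourageP; exists (f n).
Qed.

Section FromPseudometric.
Variable cntG : countable_uniformity (left_uniform_space G).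
Local Notation M := (countable_uniform cntG).

(* The entourages x^-1 y \in O are left invariant, so requiring closeness of all
   left translates costs nothing uniformly and makes the metric invariant. *)
Let B (x : G) (e : R) (y : G) : Prop :=
  forall z : G, @ball R M (z * x)%g e (z * y)%g.

Definition left_dist (x y : G) : R := inf [set e : R | 0 < e /\ B x e y].

Let lbE x y : lbound [set e : R | 0 < e /\ B x e y] 0.
Proof. by move=> e [/ltW]. Qed.

Let infE x y : has_inf [set e : R | 0 < e /\ B x e y].
Proof.
split; last by exists 0; exact: lbE.
(* The pseudometric of a countable uniformity is bounded by 2. *)
by exists 2; split=> // z; exact: countable_uniform.countable_uniform_bounded.
Qed.

Let dist_ge0 x y : 0 <= left_dist x y.
Proof. by apply: lb_le_inf; [case: (infE x y)|exact: lbE]. Qed.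

Let dist_le x y e : 0 < e -> B x e y -> left_dist x y <= e.
Proof. by move=> e0 Be; apply: ge_inf; [exact: (infE x y).2|]. Qed.

Let dist_lt x y e : left_dist x y < e -> B x e y.
Proof.
move=> /(inf_lt (infE x y).1)[e' [_ Be'] /ltW ee'] z.
exact: le_ball ee' _ (Be' z).
Qed.

Let entE : @entourage (left_uniform_space G) = entourage_ (@ball R M).
Proof. exact/esym/(@entourage_ballE R M). Qed.

Let dist_nbhs (x : G) :
  nbhs x = filter_from [set r | 0 < r] (fun r => [set y | left_dist x y < r]).
Proof.
apply/seteqP; split=> O.
  move=> nO; have : nbhs (1%g : G) [set y | O (x * y)%g].
    by apply/(nbhs1_mulr x); apply: filterS nO => y /=; rewrite mulVKg.
  move=> nO'.
  have : @entourage (left_uniform_space G)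
      [set xy : G * G | O (x * (xy.1^-1 * xy.2))%g].
    by apply/left_uniform_entourageP; exists [set y | O (x * y)%g].
  rewrite entE => -[e /= e0 eO].
  exists e => //= y /dist_lt /(_ 1%g); rewrite !mul1g => xy.
  by have := eO (x, y) xy; rewrite /= mulVKg.
move=> [r /= r0 rO]; have r2 : 0 < r / 2 by rewrite divr_gt0.
have : @entourage (left_uniform_space G)
    [set xy | @ball R M xy.1 (r / 2) xy.2].
  by rewrite entE; exists (r / 2).
move=> /left_uniform_entourageP[O' /(nbhs1_mulr x) nO' O'r].
apply: filterS nO' => y /= xy; apply: rO => /=.
apply: (@le_lt_trans _ _ (r / 2)); last by lra.
apply: dist_le => // z; apply: (O'r (z * x, z * y)%g) => /=.
by rewrite invgM -mulgA mulKg.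
Qed.

Lemma left_dist_invariant : left_invariant left_dist.
Proof.
move=> z x y; congr inf; apply/seteqP; split=> e [e0 Be]; split=> // w.
  by have := Be (w * z^-1)%g; rewrite -!mulgA !mulKg.
by rewrite !mulgA; exact: Be.
Qed.

Lemma left_dist_compatible :
  hausdorff_space G -> compatible_metric left_dist.
Proof.
move=> hausG.
have dxx x : left_dist x x = 0.
  apply/eqP; rewrite eq_le dist_ge0 andbT; apply/ler_addgt0Pr => e e0.
  by rewrite add0r; apply: dist_le => // z; exact: ballxx.
have ds x y : left_dist x y = left_dist y x.
  congr inf; apply/seteqP; split=> e [e0 Be]; split=> // z;
  exact/ball_sym/Be.
have dt y x z : left_dist x z <= left_dist x y + left_dist y z.
  apply/ler_addgt0Pr => e e0.
  have h1 : left_dist x y < left_dist x y + e / 2 by lra.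
  have h2 : left_dist y z < left_dist y z + e / 2 by lra.
  have d1 := dist_ge0 x y; have d2 := dist_ge0 y z.
  rewrite [e]splitr addrACA; apply: dist_le => [|w]; first by lra.
  exact: ball_triangle (dist_lt h1 w) (dist_lt h2 w).
split=> // x y xy0; apply: hausG => A C.
rewrite !dist_nbhs => -[r r0 rA] [s s0 sC].
exists y; split; first by apply: rA; rewrite /= xy0.
by apply: sC; rewrite /= dxx.
Qed.

End FromPseudometric.

Lemma left_invariant_metric_exists :
  hausdorff_space G -> countable_nbhs1_base ->
  exists2 d : G -> G -> R, compatible_metric d & left_invariant d.
Proof.
move=> hausG /left_uniformity_countable cntG.
exists (left_dist cntG); first exact: left_dist_compatible.
exact: left_dist_invariant.
Qed.

Lemma locally_uniform_at_sub (U V : set G) :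
  symmetric_open_nbhs V -> V `<=` U ->
  locally_uniform_at U -> locally_uniform_at V.
Proof.
move=> sV VU [_ [E cE uc]]; split=> //; exists E => // U2 A /uc[B EB BA].
exists B => // x x' y y'.
have U2sub z : U2 z -> [set (x * y)%g | x in U & y in U] z.
  by move=> [a Va [b Vb <-]]; exists a; [exact: VU|exists b => //; exact: VU].
by move=> /U2sub ? /U2sub ? /U2sub ? /U2sub ?; exact: BA.
Qed.

(** Local uniformity only concerns products of points of U, so it passes to
    any ball contained in U. *)
Lemma metric_hull_datum_exists : hausdorff_space G -> locally_uniform G ->
  countable_nbhs1_base -> inhabited (metric_hull_datum R G).
Proof.
move=> hausG [U locU] cG.
have [d dc dinv] := left_invariant_metric_exists hausG cG.
have [[d0 ds dt] _ dnbhs] := dc.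
have : nbhs (1%g : G) U.
  by case: locU => -[oU U1 _] _; exact: open_nbhs_nbhs.
rewrite dnbhs => -[r /= r0 rU].
constructor; apply: (MetricHullDatum dc dinv (mh_radius := r)).
apply: locally_uniform_at_sub locU; last first.
  by move=> x /=; rewrite ds; exact: rU.
split; first 1 last.
- by rewrite /= d0.
- by move=> x /=; rewrite -(dinv x (x^-1)%g) mulgV mulg1 ds.
rewrite openE => x /= xr; rewrite /interior dnbhs.
exists (r - d x 1%g) => /=; first by rewrite subr_gt0.
by move=> y /= xy; have := dt x y 1%g; rewrite (ds y x); lra.
Qed.

End BirkhoffKakutani.

(** If no power of t up to n_V leaves U, then t is in V: the points whose first
    n powers stay in U form a base at 1. *)
Lemma uniformly_NSS_countable_nbhs1_base (G : topologicalGroupType) :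
  uniformly_NSS_group G -> countable_nbhs1_base G.
Proof.
move=> [U nU hU].
have expg_nbhs (O : set G) i : nbhs (1%g : G) O ->
    nbhs (1%g : G) [set t | O (t ^+ i)%g].
  elim: i O => [|i IH] O nO.
    by apply: filterE => t; rewrite /= expg0; exact: nbhs_singleton.
  have [O' nO' h] := nbhs1_mul nO.
  apply: filterS (filterI nO' (IH _ nO')) => t [Ot Oti] /=.
  by rewrite expgS; exact: h.
exists (fun n => [set t : G | forall i : 'I_n.+1, U (t ^+ i)%g]).
  by move=> n; apply: filter_forall => i; exact: expg_nbhs.
move=> O /hU[n hn]; exists n => t tU; apply: contrapT => /hn[i /andP[_ ilt]].
by apply; apply: (tU (Ordinal (ilt : (i < n.+1)%N))).
Qed.

(** * Powers and saturation in the nonstandard extension *)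

Section StarPowers.
Variable N : nonstandard_universe.

Lemma smapX (G : groupType) (x : star N G) i :
  (x ^+ i)%g = smap (fun t : G => t ^+ i)%g x.
Proof.
elim: i => [|i IH]; first by rewrite expg0 star_oneE -(smap_const 1%g x).
rewrite expgS IH -{1}(smap_id x) smapM; congr smap.
by apply/funext => t; rewrite expgS.
Qed.

Lemma star_mem_std X (A : set X) (x : star N X) :
  star_mem x (std A) <-> star_set A x.
Proof.
by rewrite /star_mem -(smap_const A x) -{1}(smap_id x) spairE star_preimage.
Qed.

(** Transfer preserves finite unions: as n is standard, so is the index. *)
Lemma star_exists_leq X (A : nat -> set X) n (x : star N X) :
  star_set [set t | exists2 i, (1 <= i <= n)%N & A i t] x ->
  exists2 i, (1 <= i <= n)%N & star_set (A i) x.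
Proof.
move=> h; apply: contrapT => nA; move: h; apply/star_setC.
have h i : (1 <= i <= n)%N -> star_set (~` A i) x.
  by move=> i1n; apply/star_setC => Ai; apply: nA; exists i.
have {}h : star_set [set t | forall i, (1 <= i <= n)%N -> ~ A i t] x.
  elim: n h {nA} => [|n IH] h.
    by apply: star_subset (star_setT x) => t _ i /andP[i1 /(leq_trans i1)].
  have /star_setI : star_set [set t | forall i, (1 <= i <= n)%N -> ~ A i t] x /\
      star_set (~` A n.+1) x.
    split; last by apply: h; rewrite leqnn.
    by apply: IH => i /andP[i1 ilen]; apply: h; rewrite i1 ltnW.
  apply: star_subset => t [tn tSn] i /andP[i1].
  by rewrite leq_eqVlt => /orP[/eqP ->//|ilt]; apply: tn; rewrite i1.
by apply: star_subset h => t ht [i i1n Ait]; exact: ht Ait.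
Qed.

(** The index type of the saturation hypothesis surjects onto nat, by
    truncating the value of a function at one point. *)
Lemma countable_saturation (R : realType) (G : topologicalGroupType) X
    (A : nat -> set X) : sufficiently_saturated N R G ->
  (forall n, exists t, forall i, (i < n)%N -> A i t) ->
  exists x : star N X, forall i, star_set (A i) x.
Proof.
move=> sat hA.
pose c (k : G -> G -> R) : nat := Num.truncn (k 1%g 1%g).
have [|x hx] := sat X (fun k => std (A (c k))).
  move=> n k; have [t ht] := hA (\max_(i < n) (c (k i)).+1)%N.
  exists (std t) => i; apply/star_mem_std/star_std/ht.
  exact: (leq_bigmax (F := fun j => (c (k j)).+1) i).
exists x => i; have /star_mem_std := hx (fun _ _ => i%:R).
by rewrite /c natrK.
Qed.

End StarPowers.

(** * Neighbourhoods, powers and subgroups of a hull *)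

Section HullPowers.
Variables (N : nonstandard_universe) (R : realType).
Variables (G : topologicalGroupType) (sat : sufficiently_saturated N R G).
Variable h : hull_datum R G.
Local Notation U := (hull_U h).
Local Notation S := (hull_S h).
Local Notation Uf := (@finite_part N R G U S).
Local Notation H := (nonstandard_hull sat h).

(** The product O' * O' leaves room for an infinitesimal perturbation of x;
    this is how classes of the hull are confined to neighbourhoods of G. *)
Lemma star_set_approx (O O' : set G) (x y : star N G) :
  nbhs (1%g : G) O' -> (forall a b, O' a -> O' b -> O (a * b)%g) ->
  star_set O' x -> approx_l x y -> star_set O y.
Proof.
move=> nO' hO Ox /monadP /(_ _ nO') xy.
by rewrite -[y](mulVKg x); exact: star_setM hO Ox xy.
Qed.

Lemma hull_rep_one : approx_l (hull_rep (hull_one N h)) 1%g.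
Proof. exact/approx_sym/hull_rep_class. Qed.

(** Since S generates the left uniformity, the neighbourhoods of the identity of
    a hull are the traces of those of G, whichever S is chosen. *)
Lemma hull_nbhs1P (A : set H) : nbhs (lg_one H) A <->
  exists2 O, nbhs (1%g : G) O & [set b : H | star_set O (hull_rep b)] `<=` A.
Proof.
have rep1V : monad ((hull_rep (hull_one N h))^-1)%g.
  by have := hull_rep_one; rewrite /approx_l mulg1.
have rep1 : monad (hull_rep (hull_one N h)).
  by have := approx_sym hull_rep_one; rewrite /approx_l invg1 mul1g.
split=> [/hull_nbhsP[O nO OA]|[O nO OA]].
  have [O' nO' hO] := nbhs1_mul nO; exists O' => // b Ob; apply: OA => /=.
  by apply: star_setM hO _ Ob; move/monadP: rep1V; exact.
have [O' nO' hO] := nbhs1_mul nO; apply/hull_nbhsP; exists O' => // b Ob.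
apply: OA => /=; rewrite -[hull_rep b](mulVKg (hull_rep (hull_one N h))).
by apply: star_setM hO _ Ob; move/monadP: rep1; exact.
Qed.

(** The error stays infinitesimal because i is a standard number: there
    are finitely many multiplications, and local uniformity makes each of them
    respect infinitesimal closeness. *)
Lemma hull_rep_pow (a : H) i : (0 < i)%N -> pow_defined a i ->
  approx_l (hull_rep (lg_pow a i)) (hull_rep a ^+ i)%g.
Proof.
case: i => // i _; elim: i => [|i IH] da.
  by rewrite expg1; exact: approx_refl.
have dai : hull_dom (lg_pow a i.+1, a).
  by apply: (da i.+1 1%N) => //; rewrite addn1.
rewrite expgSr; apply: approx_trans (hull_mulP dai) _.
apply: (approx_mul (hull_locU h)); last exact: approx_refl.
  by have [[]] := hull_rep_in a.
apply: IH => j k j0 k0 jk; apply: da => //; exact: leqW.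
Qed.

Lemma uniformly_NSS_hull : uniformly_NSS_group G -> uniformly_NSS H.
Proof.
move=> [W nW hW]; have [O nO hO] := nbhs1_mul nW.
exists [set b : H | star_set O (hull_rep b)].
  by apply/hull_nbhs1P; exists O.
move=> V /hull_nbhs1P[O' /hW[n hn] O'V].
(* The bound n may vanish, whereas the exponent has to be positive. *)
exists n.+1 => // a nVa da.
have : star_set (~` O') (hull_rep a) by apply/star_setC => /O'V.
move=> /(star_subset hn) /star_exists_leq[i /andP[i1 ilen] Wi].
exists i; first by rewrite i1 leqW.
move=> Oi; move: Wi.
suff : star_set W (hull_rep a ^+ i)%g.
  rewrite smapX => /star_preimage Wi /star_setC; exact.
apply: star_set_approx nO hO Oi _; apply: hull_rep_pow => //.
by move=> j k j0 k0 jk; apply: da => //; rewrite (leq_trans jk)// leqW.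
Qed.

(** A subgroup of G^* consisting of finite points has an image in the hull,
    where all products are automatically defined: products of its elements are
    again in it, hence well inside U^*. *)
Lemma hull_subgroup (P : set (star N G)) : P 1%g ->
  (forall x y, P x -> P y -> P (x * y)%g) -> (forall x, P x -> P (x^-1)%g) ->
  P `<=` Uf ->
  lg_subgroup [set a : H | exists2 x, P x & approx_l (hull_rep a) x].
Proof.
move=> P1 PM PV PU.
have dom (a b : H) x y : P x -> P y -> approx_l (hull_rep a) x ->
    approx_l (hull_rep b) y ->
    hull_dom (a, b) /\ approx_l (hull_rep (hull_mul a b)) (x * y)%g.
  move=> Px Py ax bY.
  have abxy : approx_l (hull_rep a * hull_rep b)%g (x * y)%g.
    by apply: (approx_mul (hull_locU h)) => //; have [[]] := hull_rep_in b.
  have d : hull_dom (a, b).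
    apply/hull_domP; apply: inner_approx (approx_sym abxy) _.
    by case: (PU _ (PM _ _ Px Py)).
  by split=> //; exact: approx_trans (hull_mulP d) abxy.
split.
- by exists 1%g => //; exact: hull_rep_one.
- by [].
- by move=> [a b] [/= [x Px ax] [y Py bY]]; have [] := dom _ _ _ _ Px Py ax bY.
- move=> a b [x Px ax] [y Py bY]; exists (x * y)%g; first exact: PM.
  by have [] := dom _ _ _ _ Px Py ax bY.
- move=> a [x Px ax]; exists (x^-1)%g; first exact: PV.
  apply: approx_trans (hull_invP a) _; apply: (approx_inv (hull_locU h)) => //.
  by have [[]] := hull_rep_in a.
Qed.

End HullPowers.

(** * NSS and uniform NSS *)

(** In a subgroup contained in U all powers of an element x are defined and
    never leave U; were x not 1, the complement of x would be a neighbourhood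
    V of 1 contradicting uniform NSS. *)
Lemma uniformly_NSS_is_NSS (H : local_group) : uniformly_NSS H -> NSS H.
Proof.
move=> [U nU hU]; exists U => // K [K1 KV KM KMul KInv] KU.
apply/seteqP; split=> [x Kx|_ ->//]; apply: contrapT => x1.
have Kpow n : K (lg_pow x n).
  elim: n => // -[//|n] IH; exact: KMul.
have [|n n0 hn] := hU (~` [set x]).
  apply: open_nbhs_nbhs; split; last by move=> e; apply: x1; rewrite /= -e.
  apply: closed_openC; apply: accessible_closed_set1.
  exact/hausdorff_accessible/lg_hausdorff.
have [||i _] := hn x; first by apply.
- by move=> i j _ _ _; apply: KM; split; exact: Kpow.
- by apply; exact: KU.
Qed.

Section MetricHullNSS.
Variables (N : nonstandard_universe) (R : realType).
Variables (G : topologicalGroupType) (sat : sufficiently_saturated N R G).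

(** Near 1 both requirements on a point of a metric hull hold for free: the
    ball U bounds the distance to 1, and O * O inside U keeps the monad in
    U^*. *)
Lemma metric_hull_finite_part (m : metric_hull_datum R G) (O : set G)
    (x : star N G) : nbhs (1%g : G) O ->
  (forall a b, O a -> O b -> mh_dist m (a * b)%g 1%g < mh_radius m) ->
  star_set O x ->
  finite_part [set x | mh_dist m x 1%g < mh_radius m] [set mh_dist m] x.
Proof.
move=> nO hO Ox; 
have near y : approx_l x y ->
    star_set [set x | mh_dist m x 1%g < mh_radius m] y.
  exact: star_set_approx nO hO Ox.
have Ux := near x (approx_refl x).
split; first by split => //; exact: near.
have [dp _ _] := mh_compatible m.
move=> _ ->; exists (mh_radius m).
rewrite star_oneE -(smap_const 1%g x) -{1}(smap_id x) smap2E.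
apply/star_preimage; apply: star_subset Ux => a /= /ltW.
by rewrite ger0_norm//; exact: pseudometric_ge0.
Qed.

(** If W refuted uniform NSS of G, saturation would yield a noninfinitesimal x
    with all standard powers in W^*, and the classes of these powers would form
    a nontrivial subgroup of the hull inside V.  Symmetry of W takes care of
    the negative powers. *)
Lemma metric_hull_NSS_uniformly_NSS (m : metric_hull_datum R G) :
  NSS (metric_nonstandard_hull sat m) -> uniformly_NSS_group G.
Proof.
move=> [V /hull_nbhs1P[O nO OV] trivV].
have nU : nbhs (1%g : G) [set x | mh_dist m x 1%g < mh_radius m].
  by case: (mh_locU m) => -[oU U1 _] _; exact: open_nbhs_nbhs.
have [O1 nO1 hO1] := nbhs1_mul (filterI nO nU).
pose W := O1 `&` [set a | O1 (a^-1)%g].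
have nW : nbhs (1%g : G) W by exact/filterI/nbhs1_inv.
have WV a : W a -> W (a^-1)%g by move=> [? ?]; split => //=; rewrite invgK.
exists W => // V' nV'; apply: contrapT => noBound.
have [|x hx] := @countable_saturation N R G G
    (fun i => [set t | ~ V' t /\ W (t ^+ i)%g]) sat.
  move=> n; apply: contrapT => nt; apply: noBound; exists n => t nV't.
  apply: contrapT => noi; apply: nt; exists t => -[|i] ilt; split=> //.
    by rewrite expg0; exact: nbhs_singleton.
  by apply: contrapT => nWi; apply: noi; exists i.+1 => //; exact: ltnW.
have Wx i : star_set W (x ^+ i)%g.
  by rewrite smapX; apply/star_preimage; apply: star_subset (hx i) => t [].
(* The powers x ^ (i - j) with integer exponents, as differences of naturals to
   avoid a case distinction in the group law. *)
pose P := [set y | exists i j, y = (x ^+ i * (x ^+ j)^-1)%g].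
have PW : P `<=` star_set W.
  move=> _ [i [j ->]]; have [ij|/ltnW ji] := leqP i j.
    by rewrite -(subnK ij) expgnDr invgM mulVKg; exact: star_setV WV (Wx _).
  by rewrite -expgnFr.
have PM y z : P y -> P z -> P (y * z)%g.
  move=> [i [j ->]] [k [l ->]]; exists (i + k)%N, (l + j)%N.
  rewrite !expgnDr invgM !mulgA; congr (_ * _)%g.
  rewrite -!mulgA; congr (_ * _)%g.
  by apply: commute_sym; apply: commuteV; apply: commuteX2; exact: commute_refl.
have PV y : P y -> P (y^-1)%g.
  by move=> [i [j ->]]; exists j, i; rewrite invgM invgK.
have P1 : P 1%g by exists 0, 0; rewrite mulgV.
have nearP y z : P y -> approx_l y z ->
    star_set (O `&` [set x | mh_dist m x 1%g < mh_radius m]) z.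
  by move=> /PW /star_setI[O1y _]; exact: star_set_approx nO1 hO1 O1y.
have PU : P `<=` finite_part (hull_U (metric_hull_parameters m))
    (hull_S (metric_hull_parameters m)).
  move=> y /PW /star_setI[O1y _]; apply: metric_hull_finite_part nO1 _ O1y.
  by move=> a b Oa Ob; have [] := hO1 a b Oa Ob.
have subP := hull_subgroup sat P1 PM PV PU.
have Px : P x by exists 1, 0; rewrite expg0 expg1 invg1 mulg1.
have KV : [set a | exists2 y, P y & approx_l (hull_rep a) y] `<=` V.
  move=> a [y Py ay]; apply: OV.
  by have /star_setI[] := nearP _ _ Py (approx_sym ay).
have := trivV _ subP KV => K1.
have : [set lg_one (metric_nonstandard_hull sat m)] (hull_class (PU _ Px)).
  by rewrite -K1; exists x => //; exact/approx_sym/hull_rep_class.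
move=> /hull_eqP xe.
have /monadP /(_ _ nV') : monad x.
  have : approx_l 1%g x.
    apply: approx_trans (approx_sym (hull_rep_one _ _)) _.
    by apply: approx_trans (approx_sym xe) _; exact/approx_sym/hull_rep_class.
  by rewrite /approx_l invg1 mul1g.
have : star_set (~` V') x by apply: star_subset (hx 0) => t [].
by move/star_setC.
Qed.

End MetricHullNSS.

Theorem proposition6p4 (R : realType) (N : nonstandard_universe)
    (G : topologicalGroupType) (sat : sufficiently_saturated N R G)
    (hausG : hausdorff_space G) (locG : locally_uniform G) :
  [<-> uniformly_NSS_group G;
       metrizable R G /\ the_metric_hull_is sat uniformly_NSS;
       metrizable R G /\ the_metric_hull_is sat NSS;
       metrizable R G /\
         forall h : hull_datum R G, NSS (nonstandard_hull sat h)].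
Proof.
tfae.
- move=> unssG; have [m] := metric_hull_datum_exists R hausG locG
    (uniformly_NSS_countable_nbhs1_base unssG).
  split; first by exists (mh_dist m); exact: mh_compatible.
  by split=> // m'; exact: uniformly_NSS_hull.
- move=> [mG [im hm]]; split=> //; split=> // m.
  exact/uniformly_NSS_is_NSS/hm.
- move=> [mG [[m] hm]]; split=> // h; apply: uniformly_NSS_is_NSS.
  exact/uniformly_NSS_hull/(metric_hull_NSS_uniformly_NSS (hm m)).
- move=> [/metrizable_countable_nbhs1_base cG hG].
  have [m] := metric_hull_datum_exists R hausG locG cG.
  exact/(@metric_hull_NSS_uniformly_NSS _ _ _ sat m)/hG.
Qed.
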